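(* Let $n\ge 1$ and let $D=\Omega+i\mathbb{R}^{n+1}\subset\mathbb{C}^{n+1}$ be a tube domain whose base $\Omega\subset\mathbb{R}^{n+1}$ is an affinely homogeneous domain. Let $\Gamma$ be a part of the boundary of $\Omega$ that is a smooth hypersurface with definite second fundamental form, and suppose that the group of affine symmetries acts locally transitively on $\Gamma$. Then $\Gamma$ is (as a local hypersurface) affinely equivalent to the hypersurface $$x_{n+1}=\sum_{i=1}^n x_i^2 .$$
   Context: A domain $\Omega\subset\mathbb{R}^{n+1}$ is affinely homogeneous if the group of affine transformations of $\mathbb{R}^{n+1}$ preserving $\Omega$ acts transitively on $\Omega$. The tube domain over $\Omega$ is $\Omega+i\mathbb{R}^{n+1}=\{x+iy: x\in\Omega,\ y\in\mathbb{R}^{n+1}\}$, and $\Omega$ is its base. The part of the boundary of the tube domain in question is $\Gamma+i\mathbb{R}^{n+1}$; it is described by the hypersurface $\Gamma\subset\mathbb{R}^{n+1}$. The second fundamental form of a hypersurface is the affinely defined quadratic form on tangent spaces given, up to a nonzero factor, by the Hessian of a local graphing function over the tangent hyperplane; definite means positive or negative definite. Affine equivalence is local: an open piece of one hypersurface is mapped to an open piece of the other by an invertible affine map of $\mathbb{R}^{n+1}$. *)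

(* Defs.v *)
From HB Require Import structures.
From mathcomp Require Import all_boot all_order all_algebra.
From mathcomp Require Import complex.
From mathcomp Require Import all_classical all_reals all_analysis.
Set Implicit Arguments.
Unset Strict Implicit.
Unset Printing Implicit Defensive.
Import Order.TTheory GRing.Theory Num.Theory.
Import numFieldNormedType.Exports.
Local Open Scope classical_set_scope.
Local Open Scope ring_scope.

Definition affine_transformation (R : realType) (m : nat)
    (g : 'rV[R]_m -> 'rV[R]_m) : Prop :=
  exists (A : 'M[R]_m) (b : 'rV[R]_m),
    A \in unitmx /\ (forall x, g x = x *m A + b).

Definition affine_symmetry (R : realType) (m : nat) (Omega : set 'rV[R]_m)
    (g : 'rV[R]_m -> 'rV[R]_m) : Prop :=
  affine_transformation g /\ g @` Omega = Omega.

Definition domain (R : realType) (m : nat) (Omega : set 'rV[R]_m) : Prop :=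
  [/\ Omega !=set0, open Omega & connected Omega].

Definition affinely_homogeneous (R : realType) (m : nat)
    (Omega : set 'rV[R]_m) : Prop :=
  forall x y, Omega x -> Omega y ->
    exists2 g, affine_symmetry Omega g & g x = y.

Definition tube (R : realType) (m : nat) (Omega : set 'rV[R]_m) :
    set 'rV[R[i]]_m :=
  [set z | exists x y : 'rV[R]_m,
             Omega x /\ z = \row_j (x ord0 j +i* y ord0 j)%C].

Definition boundary (R : realType) (m : nat) (S : set 'rV[R]_m) :
    set 'rV[R]_m :=
  closure S `\` interior S.

(* A part of the boundary is a nonempty relatively open subset of it. *)
Definition boundary_part (R : realType) (m : nat)
    (Omega Gamma : set 'rV[R]_m) : Prop :=
  Gamma !=set0 /\
  exists W : set 'rV[R]_m, open W /\ Gamma = boundary Omega `&` W.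

(* The group is that of all affine symmetries of Omega; its orbit through each
   point of Gamma is required to contain a neighbourhood of it in Gamma. *)
Definition acts_locally_transitively (R : realType) (m : nat)
    (Omega Gamma : set 'rV[R]_m) : Prop :=
  forall p, Gamma p -> \forall q \near p, Gamma q ->
    exists2 g, affine_symmetry Omega g & g p = q.

Definition init_coords (R : realType) (n : nat) (x : 'rV[R]_n.+1) :
    'rV[R]_n :=
  \row_(i < n) x ord0 (widen_ord (leqnSn n) i).

Definition graph_over (R : realType) (n : nat) (f : 'rV[R]_n -> R) :
    set 'rV[R]_n.+1 :=
  [set x : 'rV[R]_n.+1 | x ord0 ord_max = f (init_coords x)].

(* C^infinity near y: all iterated directional derivatives are Frechet
   differentiable on a common neighbourhood of y. *)
Definition smooth_near (R : realType) (n : nat) (f : 'rV[R]_n -> R)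
    (y : 'rV[R]_n) : Prop :=
  \forall z \near y, forall vs : seq 'rV[R]_n,
    differentiable (foldr (fun v h => 'D_v h) (f : 'rV[R]_n -> R^o) vs) z.

(* In the affine coordinates g, the set S is near p the graph of f. *)
Definition local_graph (R : realType) (n : nat) (S : set 'rV[R]_n.+1)
    (p : 'rV[R]_n.+1) (g : 'rV[R]_n.+1 -> 'rV[R]_n.+1)
    (f : 'rV[R]_n -> R) : Prop :=
  [/\ affine_transformation g, smooth_near f (init_coords (g p)) &
      \forall x \near p, S x <-> graph_over f (g x)].

Definition smooth_hypersurface (R : realType) (n : nat)
    (S : set 'rV[R]_n.+1) : Prop :=
  forall p, S p -> exists g f, local_graph S p g f.

(* A graphing function over the tangent hyperplane of S at p: the affine
   coordinates g send p to 0 and the tangent hyperplane to {x_(n+1) = 0}. *)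
Definition tangent_graph (R : realType) (n : nat) (S : set 'rV[R]_n.+1)
    (p : 'rV[R]_n.+1) (f : 'rV[R]_n -> R) : Prop :=
  exists g, [/\ local_graph S p g f, g p = 0, f 0 = 0 &
                forall v, 'D_v (f : 'rV[R]_n -> R^o) 0 = 0].

Definition hessian_form (R : realType) (n : nat) (f : 'rV[R]_n -> R)
    (y v : 'rV[R]_n) : R :=
  'D_v ('D_v (f : 'rV[R]_n -> R^o)) y.

Definition definite_form (R : realType) (n : nat) (q : 'rV[R]_n -> R) : Prop :=
  (forall v, v != 0 -> 0 < q v) \/ (forall v, v != 0 -> q v < 0).

(* The Hessian at 0 of a tangent graphing function depends on the choice of
   that function only up to a nonzero factor and a linear change of variables,
   so that one graphing function suffices. *)
Definition definite_second_fundamental_form (R : realType) (n : nat)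
    (S : set 'rV[R]_n.+1) : Prop :=
  forall p, S p ->
    exists2 f, tangent_graph S p f & definite_form (hessian_form f 0).

(* Every point of S lies in an open piece of S that an invertible affine map
   sends onto an open piece of T. *)
Definition locally_affinely_equivalent (R : realType) (m : nat)
    (S T : set 'rV[R]_m) : Prop :=
  S !=set0 /\
  forall p, S p -> exists (g : 'rV[R]_m -> 'rV[R]_m) (U V : set 'rV[R]_m),
    [/\ affine_transformation g, open U /\ U p, open V &
        g @` (S `&` U) = T `&` V].

Definition paraboloid (R : realType) (n : nat) : set 'rV[R]_n.+1 :=
  graph_over (fun y : 'rV[R]_n => \sum_(i < n) y ord0 i ^+ 2).

(* Main.v *)
Require Import Defs.
From HB Require Import structures.
From mathcomp Require Import all_boot all_order all_algebra.
From mathcomp Require Import complex.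
From mathcomp Require Import all_classical all_reals all_analysis.
From mathcomp Require Import ring lra.
Set Implicit Arguments.
Unset Strict Implicit.
Unset Printing Implicit Defensive.
Import Order.TTheory GRing.Theory Num.Theory.
Import numFieldNormedType.Exports.
Local Open Scope classical_set_scope.
Local Open Scope ring_scope.

(** The tangent hyperplane at a point p of Gamma being horizontal, Gamma is a
    graph z = f y near p = 0, with f 0 = 0, Df(0) = 0 and definite Hessian H0.
    The idea is to find a symmetry of Omega that fixes p and contracts Gamma
    towards p. As Gamma is invariant under its iterates, only the second order
    part of Gamma at p survives, and Gamma is a quadric.

    To find it, let (eta, 1) span the affine normal of Gamma at p. One side of
    Gamma lies in Omega ([one_side]), so that Omega contains a point
    X = s0 (eta, 1) at a small height s0. By homogeneity every point
    (1 + t) X with t small is the image of X by a symmetry of Omega. There are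
    uncountably many of them while the affine group is separable, so that two
    of these symmetries are as close to each other as desired; their quotient is
    a symmetry close to the identity which maps S (eta, 1) to S' (eta, 1) with
    S' / S in (0, 1) ([small_symmetry]).

    Such a symmetry preserves Gamma near p, which is the functional equation
    f (y A + f y b + a) = y c + d f y + e. Its first three derivatives at 0
    relate the jet of f at a to the jet of f at 0 ([jet1], [jet2], [jet3]). The
    trace of the third order relation with respect to H0 expresses that the
    affine normal is carried to the affine normal, and pins down b up to an
    error of order |a| ([translation_near]). Hence the affine normals at p and
    at the image (a, f a) of p differ by O(|a|), while both pass through the
    point S' (eta, 1), whose height is small: this is possible only for a = 0,
    that is, when p is fixed ([isotropy_of_normal_line]).

    Then d = S' / S < 1 and A multiplies H0 by d, so that the definiteness of
    H0 makes the symmetry a contraction. It follows that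
    f y = H0 (y - f y eta) / 2, where H0 is seen as a quadratic form
    ([invariant_graph_quadric]), and a linear change of coordinates maps this
    quadric to the paraboloid ([graph_near_paraboloid]). *)

(** * Directional derivatives *)

(** The pointwise content of [smooth_near], which is stable under directional
    derivatives. *)
Definition smooth_at (R : realType) (n : nat) (f : 'rV[R]_n -> R)
    (z : 'rV[R]_n) : Prop :=
  forall vs : seq 'rV[R]_n,
    differentiable (foldr (fun v h => 'D_v h) (f : 'rV[R]_n -> R^o) vs) z.

Lemma smooth_at_differentiable (R : realType) (n : nat) (f : 'rV[R]_n -> R^o) z :
  smooth_at f z -> differentiable f z.
Proof. by move=> /(_ [::]). Qed.

Lemma smooth_at_derive (R : realType) (n : nat) (f : 'rV[R]_n -> R^o) v z :
  smooth_at f z -> smooth_at ('D_v f) z.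
Proof. by move=> fz vs; have := fz (rcons vs v); rewrite foldr_rcons. Qed.

Section Derivative.
Variables (R : realType) (n : nat).
Implicit Types (f F : 'rV[R]_n -> R^o) (u v w x y : 'rV[R]_n).

Lemma derive_add f x u v : differentiable f x ->
  'D_(u + v) f x = 'D_u f x + 'D_v f x.
Proof. by move=> df; rewrite !deriveE // linearD. Qed.

Lemma derive_scale f x (a : R) v : differentiable f x ->
  'D_(a *: v) f x = a * 'D_v f x.
Proof. by move=> df; rewrite !deriveE // linearZ. Qed.

Lemma derive_coord f x v : differentiable f x ->
  'D_v f x = \sum_i v ord0 i * 'D_(delta_mx ord0 i) f x.
Proof.
move=> df; rewrite {1}(row_sum_delta v) deriveE // linear_sum.
by apply: eq_bigr => i _; rewrite linearZ deriveE.
Qed.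

(** An affine map of R^(n+1), restricted to the graph of f and projected to the
    first coordinates, has this shape: b is the image of the vertical vector. *)
Lemma diff_affine_graph (k p : nat) (f : 'rV[R]_k -> R^o)
    (A : 'M[R]_(k, p)) (b a : 'rV[R]_p) (x v : 'rV[R]_k) :
  let phi := fun w : 'rV[R]_k => w *m A + f w *: b + a in
  differentiable f x ->
  differentiable phi x /\ 'd phi x v = v *m A + 'd f x v *: b.
Proof.
move=> phi df.
pose m : {linear 'rV[R]_k -> 'rV[R]_p} := mulmxr A.
have cm : continuous m.
  move=> z; apply: differentiable_continuous.
  have -> : (m : 'rV[R]_k -> 'rV[R]_p) = \sum_(i < k) (fun w : 'rV[R]_k =>
    (w ord0 i : R) *: row i A).
    apply/funext=> w; rewrite fct_sumE /m /= mulmx_sum_row.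
    by apply: eq_bigr.
  apply: differentiable_sum => i; apply: differentiableZl.
  exact: differentiable_coord.
have dm z : differentiable m z by exact: linear_differentiable.
have dfb : differentiable (fun w : 'rV[R]_k => f w *: b) x by exact: differentiableZl.
pose g (w : 'rV[R]_k) : 'rV[R]_p := f w *: b.
have dmg := differentiableD (dm x) dfb.
have dc := @differentiable_cst _ _ _ a x.
have dphi : differentiable phi x := differentiableD dmg dc.
split=> //.
have ev (V W : Type) (h h' : V -> W) (z : V) : h = h' -> h z = h' z by move=> ->.
apply: etrans (ev _ _ _ _ v (diffD dmg dc)) _.
apply: etrans (congr2 +%R (ev _ _ _ _ v (diffD (dm x) dfb)) (ev _ _ _ _ v (diff_cst a x))) _.
apply: etrans (addr0 _) _.
have e3 : 'd m x v = v *m A := ev _ _ _ _ v (diff_lin x cm).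
have e4 : 'd g x v = 'd f x v *: b := ev _ _ _ _ v (diffZl b df).
by rewrite -e4 -e3.
Qed.

Lemma derive_comp_affine (k p : nat) (F : 'rV[R]_p -> R^o) (f : 'rV[R]_k -> R^o)
    (A : 'M[R]_(k, p)) (b a : 'rV[R]_p) (x v : 'rV[R]_k) :
  let phi := fun w : 'rV[R]_k => w *m A + f w *: b + a in
  differentiable f x -> differentiable F (phi x) ->
  differentiable (F \o phi) x /\
  'D_v (F \o phi) x = 'D_(v *m A) F (phi x) + 'D_v f x * 'D_b F (phi x).
Proof.
move=> phi df dF; have [dphi dphiE] := diff_affine_graph A b a v df.
split; first exact: differentiable_comp.
rewrite !deriveE //; last exact: differentiable_comp.
have ev (V W : Type) (h h' : V -> W) (z : V) : h = h' -> h z = h' z by move=> ->.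
apply: etrans (ev _ _ _ _ v (diff_comp dphi dF)) _.
rewrite -[X in X = _]/('d F (phi x) ('d phi x v)) dphiE.
by rewrite linearD linearZ.
Qed.

Lemma diff_first_order F (e : R) : 0 < e -> differentiable F 0 ->
  \forall y \near (0 : 'rV[R]_n), `|F y - F 0 - 'D_y F 0| <= e * `|y|.
Proof.
move=> e0 dF; have /eqaddoP/(_ _ e0) := diff_locally dF.
apply: filterS => y; rewrite deriveE //.
by rewrite -[X in `|X| <= _ -> _]/(F (y + 0) - (F 0 + 'd F 0 y)) addr0 opprD addrA.
Qed.

Lemma diff_lipschitz F : differentiable F 0 ->
  exists2 K, 0 < K & \forall y \near (0 : 'rV[R]_n), `|F y - F 0| <= K * `|y|.
Proof.
move=> dF; have [k k0 kP] := linear_lipschitz (diff_continuous dF).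
exists (k + 1); first by rewrite addr_gt0.
have := diff_first_order ltr01 dF; apply: filterS => y; rewrite deriveE // => H.
rewrite -(subrK ('d F 0 y) (F y - F 0)); apply: (le_trans (ler_normD _ _)).
by rewrite mulrDl addrC lerD.
Qed.

(** Restricting to lines is what makes the mean value theorem available. *)
Lemma derive_line F x v (r : R) : differentiable F (x + r *: v) ->
  is_derive r 1 (fun t : R => F (x + t *: v)) ('D_v F (x + r *: v)).
Proof.
move=> dF.
have dlv : differentiable (fun t : R => t *: v) r by exact: differentiableZl.
have dx := @differentiable_cst _ _ _ x r.
have dl : differentiable (fun t : R => x + t *: v) r := differentiableD dx dlv.
apply: DeriveDef.
  by apply: diff_derivable; apply: (differentiable_comp dl).
rewrite !deriveE //; last by apply: (differentiable_comp dl).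
have ev (V W : Type) (h h' : V -> W) (z : V) : h = h' -> h z = h' z by move=> ->.
apply: etrans (ev _ _ _ _ (1 : R) (diff_comp dl dF)) _.
rewrite -[X in X = _]/('d F (x + r *: v) ('d (fun t : R => x + t *: v) r (1 : R))).
have -> : 'd (fun t : R => x + t *: v) r (1 : R) = v.
  apply: etrans (ev _ _ _ _ (1 : R) (diffD dx dlv)) _.
  have e3 : 'd (cst x : R -> 'rV[R]_n) r (1 : R) = 0 := ev _ _ _ _ (1 : R) (diff_cst x r).
  have did : differentiable (id : R -> R) r by [].
  have e4 : 'd (fun t : R => t *: v) r (1 : R) = 'd (id : R -> R) r (1 : R) *: v :=
    ev _ _ _ _ (1 : R) (diffZl v did).
  have e5 : 'd (id : R -> R) r (1 : R) = 1 by rewrite diff_val.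
  by apply: etrans (congr2 +%R e3 e4) _; rewrite e5 scale1r add0r.
by [].
Qed.

Lemma mean_value_unit (g dg : R -> R) :
  (forall t : R, 0 <= t <= 1 -> is_derive t 1 g (dg t)) ->
  exists2 t : R, 0 < t < 1 & g 1 - g 0 = dg t.
Proof.
move=> dgP; have [||c] := @MVT R g dg 0 1 ltr01.
- by move=> x; rewrite in_itv /= => /andP[x0 x1]; apply: dgP; rewrite !ltW.
- apply: derivable_within_continuous => x; rewrite in_itv /= => x01.
  by case: (dgP _ x01).
- by rewrite in_itv /= subr0 mulr1 => c01 ->; exists c.
Qed.

Lemma mx_entry_le (p q : nat) (M : 'M[R]_(p, q)) i j : `|M i j| <= `|M|.
Proof.
rewrite [leRHS]/Num.norm /= mx_normrE.
by apply/bigmax_geP; right => /=; exists (i, j).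
Qed.

Lemma mx_norm_le (p q : nat) (M : 'M[R]_(p, q)) (e : R) : 0 <= e ->
  (forall i j, `|M i j| <= e) -> `|M| <= e.
Proof.
move=> e0 Me; rewrite [leLHS]/Num.norm /= mx_normrE.
by apply/bigmax_leP; split => // -[i j] _ /=.
Qed.

Lemma diff_lipschitz_finite (J : finType) (F : J -> 'rV[R]_n -> R^o) :
  (forall j, differentiable (F j) 0) ->
  exists2 K, 0 < K & \forall y \near (0 : 'rV[R]_n), forall j, `|F j y - F j 0| <= K * `|y|.
Proof.
move=> dF.
have HK : forall j, exists K, 0 < K /\ \forall y \near (0 : 'rV[R]_n),
  `|F j y - F j 0| <= K * `|y|.
  by move=> j; have [K K0 KP] := diff_lipschitz (dF j); exists K.
have [K KP] := choice HK.
have K0 j : 0 <= K j by case: (KP j) => /ltW.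
exists (1 + \sum_j K j); first by rewrite ltr_pwDl // sumr_ge0.
pose P (j : J) := [set y | `|F j y - F j 0| <= K j * `|y|].
have Hj j : \forall y \near (0 : 'rV[R]_n), P j y by case: (KP j).
have H : \forall y \near (0 : 'rV[R]_n), forall j, P j y by exact: (filter_forall _ Hj).
move: H; apply: filterS => y Py j.
apply: (le_trans (Py j)); rewrite ler_wpM2r //.
by rewrite (bigD1 j) //= addrCA lerDl addr_ge0 // sumr_ge0.
Qed.

(** Both sides are linear in v, so that a bound on the basis vectors is uniform
    in v. *)
Lemma derive_first_order f (e : R) : 0 < e -> differentiable f 0 ->
  (\forall y \near (0 : 'rV[R]_n), differentiable f y) ->
  (forall v, differentiable ('D_v f) 0) ->
  \forall y \near (0 : 'rV[R]_n), forall v,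
    `|'D_v f y - 'D_v f 0 - 'D_y ('D_v f) 0| <= e * `|y| * `|v|.
Proof.
move=> e0 df0 df ddf.
have e'0 : 0 < e / n.+1%:R by rewrite divr_gt0 ?ltr0n.
have H : \forall y \near (0 : 'rV[R]_n), forall i, `|'D_(delta_mx ord0 i) f y -
   'D_(delta_mx ord0 i) f 0 - 'D_y ('D_(delta_mx ord0 i) f) 0| <= e / n.+1%:R * `|y|.
  pose P (i : 'I_n) := [set y | `|'D_(delta_mx ord0 i) f y -
    'D_(delta_mx ord0 i) f 0 - 'D_y ('D_(delta_mx ord0 i) f) 0| <= e / n.+1%:R * `|y|].
  have Hi i : \forall y \near (0 : 'rV[R]_n), P i y.
    by apply: diff_first_order => //; exact: ddf.
  exact: (filter_forall _ Hi).
have DE v y : 'D_y ('D_v f) 0 = \sum_i v ord0 i * 'D_y ('D_(delta_mx ord0 i) f) 0.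
  transitivity ('D_y (\sum_i v ord0 i *: ('D_(delta_mx ord0 i) f : _ -> R^o)) 0).
    apply: near_eq_derive; move: df; apply: filterS => z dz.
    by rewrite derive_coord // fct_sumE.
  rewrite derive_sum; last by move=> i; apply: derivableZ; exact: diff_derivable.
  by apply: eq_bigr => i _; rewrite deriveZ //; exact: diff_derivable.
apply: filterS2 H df => y H dfy v.
rewrite DE (derive_coord _ dfy) (derive_coord _ df0) -!sumrB.
apply: (le_trans (ler_norm_sum _ _ _)).
apply: (@le_trans _ _ (\sum_(i < n) `|v| * (e / n.+1%:R * `|y|))).
  apply: ler_sum => i _; rewrite -!mulrBr normrM ler_pM //.
  exact: mx_entry_le.
rewrite sumr_const card_ord -[leLHS]mulr_natr.
have -> : `|v| * (e / n.+1%:R * `|y|) * n%:R = (e * `|y| * `|v|) * (n%:R / n.+1%:R).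
  by set m := (n.+1%:R)^-1; ring.
rewrite ler_piMr ?mulr_ge0 ?(ltW e0) // ler_pdivrMr ?ltr0n // mul1r ler_nat.
exact: leqnSn.
Qed.

Lemma ball0_near (P : set 'rV[R]_n) : (\forall y \near (0 : 'rV[R]_n), P y) <->
  exists2 r, 0 < r & forall y, `|y| < r -> P y.
Proof.
split; first by move/nbhs_norm0P => [r r0 H]; exists r.
by move=> [r r0 H]; apply/nbhs_norm0P; exists r.
Qed.

(** The mean value theorem on a segment of direction u turns the second
    difference of f into an increment of its derivative along u, to which the
    differentiability of this derivative at 0 applies. *)
Lemma second_difference f u v (e : R) : 0 < e ->
  (\forall y \near (0 : 'rV[R]_n), differentiable f y) ->
  (forall w, differentiable ('D_w f) 0) ->
  \forall t \near (0 : R)^'+,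
    `|f (t *: u + t *: v) - f (t *: u) - f (t *: v) + f 0 - t ^+ 2 * 'D_v ('D_u f) 0|
       <= e * t ^+ 2.
Proof.
move=> e0 df ddf.
pose c := 2 * (`|u| + `|v|) + 1.
have c0 : 0 < c by apply: ltr_wpDl; rewrite ?mulr_ge0 ?addr_ge0.
have ec : 0 < e / c by rewrite divr_gt0.
have /ball0_near[r r0 rP] := diff_first_order ec (ddf u).
have /ball0_near[r' r'0 r'P] := df.
near=> t.
have t0 : 0 < t by near: t; exact: nbhs_right_gt.
have tr : t * c < Num.min r r'.
  rewrite -ltr_pdivlMr //; near: t; apply: nbhs_right_lt.
  by rewrite divr_gt0 // lt_min r0.
move: tr; rewrite lt_min => /andP[tr tr'].
have bnd (a b : R) : 0 <= a <= t -> 0 <= b <= t -> `|a *: u + b *: v| <= t * (`|u| + `|v|).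
  move=> /andP[a0 at_] /andP[b0 bt]; apply: (le_trans (ler_normD _ _)).
  by rewrite !normrZ !ger0_norm // mulrDr lerD // ler_wpM2r.
have bnd2 (a b : R) : 0 <= a <= t -> 0 <= b <= t -> `|a *: u + b *: v| < t * c.
  move=> Ha Hb; apply: (le_lt_trans (bnd _ _ Ha Hb)).
  rewrite ltr_pM2l // /c.
  have : 0 <= `|u| + `|v| by rewrite addr_ge0.
  by lra.
pose g s := f (t *: v + s *: (t *: u)) - f (0 + s *: (t *: u)).
pose dg s := 'D_(t *: u) f (t *: v + s *: (t *: u)) - 'D_(t *: u) f (0 + s *: (t *: u)).
have sP s : 0 <= s <= 1 -> 0 <= s * t <= t.
  by move=> /andP[s0 s1]; rewrite mulr_ge0 ?(ltW t0) //= ger_pMl.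
have tt : 0 <= t <= t by rewrite ltW //=.
have df1 s : 0 <= s <= 1 -> differentiable f (t *: v + s *: (t *: u)).
  move=> /sP s01; apply: r'P; apply: (le_lt_trans _ tr'); apply: ltW.
  by rewrite scalerA addrC; exact: bnd2.
have df2 s : 0 <= s <= 1 -> differentiable f (0 + s *: (t *: u)).
  move=> /sP s01; apply: r'P; apply: (le_lt_trans _ tr'); apply: ltW.
  by rewrite scalerA add0r -[_ *: u]addr0 -[0](scale0r v); apply: bnd2; rewrite // lexx ltW.
have [s s01 gE] : exists2 s : R, 0 < s < 1 & g 1 - g 0 = dg s.
  apply: mean_value_unit => s s01.
  by apply: is_deriveB; apply: derive_line; [exact: df1|exact: df2].
have {}s01 : 0 <= s <= 1 by case/andP: s01 => *; rewrite !ltW.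
have -> : f (t *: u + t *: v) - f (t *: u) - f (t *: v) + f 0 = dg s.
  rewrite -gE /g !scale1r !scale0r !addr0 !add0r [t *: v + _]addrC; ring.
rewrite /dg !derive_scale //; [|exact: df2|exact: df1].
have := rP (0 + s *: (t *: u)); have := rP (t *: v + s *: (t *: u)).
set y1 := t *: v + _; set y2 := 0 + s *: _.
have n1 : `|y1| <= t * (`|u| + `|v|).
  by rewrite /y1 scalerA addrC bnd // sP.
have n2 : `|y2| <= t * (`|u| + `|v|).
  rewrite /y2 add0r -[_ *: (_ *: u)]addr0 -[0](scale0r v) scalerA; apply: bnd; first exact: sP.
  by rewrite lexx ltW.
have tc : t * (`|u| + `|v|) < t * c.
  have : 0 <= `|u| + `|v| by rewrite addr_ge0.
  by rewrite ltr_pM2l // /c; lra.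
move=> /(_ (le_lt_trans n1 (lt_trans tc tr))) h1.
move=> /(_ (le_lt_trans n2 (lt_trans tc tr))) h2.
have -> : t ^+ 2 * 'D_v ('D_u f) 0 = t * ('D_y1 ('D_u f) 0 - 'D_y2 ('D_u f) 0).
  rewrite /y1 /y2 add0r (derive_add _ _ (ddf u)) !(derive_scale _ _ (ddf u)).
  by move: ('D_u _ _) ('D_v _ _) => p q; ring.
rewrite -mulrBr -mulrBr normrM gtr0_norm //.
have -> : e * t ^+ 2 = t * (e * t) by ring.
rewrite ler_pM2l //.
have tri (x1 x2 z b1 b2 : R) : x1 - x2 - (b1 - b2) = (x1 - z - b1) - (x2 - z - b2) by ring.
rewrite (tri _ _ ('D_u f 0)).
apply: (le_trans (ler_normB _ _)); apply: (le_trans (lerD h1 h2)).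
rewrite -mulrDr mulrAC ler_pdivrMr // -mulrA ler_pM2l //.
apply: (le_trans (lerD n1 n2)); rewrite -mulrDr ler_pM2l // /c.
by move: (`|u| + `|v|); clear=> q; lra.
Unshelve. all: by end_near. Qed.

(** The second difference is symmetric in u and v. *)
Lemma second_derivative_symmetric f u v :
  (\forall y \near (0 : 'rV[R]_n), differentiable f y) ->
  (forall w, differentiable ('D_w f) 0) ->
  'D_u ('D_v f) 0 = 'D_v ('D_u f) 0.
Proof.
move=> df ddf; apply/eqP; rewrite -subr_eq0 -normr_le0; apply/ler_addgt0Pl => e e0;
  rewrite addr0.
have e2 : 0 < e / 2 by rewrite divr_gt0.
have H1 := second_difference u v e2 df ddf.
have H2 := second_difference v u e2 df ddf.
have H3 := nbhs_right_gt (0 : R).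
pose proof (filter_ex (filterI H1 (filterI H2 H3))) as [t [h1 [h2 t0]]].
move: h1 h2; rewrite [t *: v + _]addrC => h1 h2.
have t2 : 0 < t ^+ 2 by rewrite exprn_gt0.
rewrite -(ler_pM2r t2) -[X in _ * X](gtr0_norm t2) -normrM.
have tri (D a b c q p s : R) : (p - q) * s =
  (D - a - b + c - s * q) - (D - b - a + c - s * p) by ring.
rewrite (tri (f (t *: u + t *: v)) (f (t *: u)) (f (t *: v)) (f 0)).
apply: (le_trans (ler_normB _ _)); apply: (le_trans (lerD h1 h2)).
by rewrite -mulrDl -splitr.
Qed.

(** Subtracting the quadratic term along the segment from 0 to v, the mean value
    theorem reduces the claim to the first order expansion of the derivative in
    the direction v. *)
Lemma taylor_second_order f (e : R) : 0 < e -> f 0 = 0 -> (forall v, 'D_v f 0 = 0) ->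
  (\forall y \near (0 : 'rV[R]_n), differentiable f y) ->
  (forall w, differentiable ('D_w f) 0) ->
  \forall v \near (0 : 'rV[R]_n), `|f v - 2^-1 * 'D_v ('D_v f) 0| <= e * `|v| ^+ 2.
Proof.
move=> e0 f0 Df0 df ddf.
have /ball0_near[r r0 rP] := derive_first_order e0 (nbhs_singleton df) df ddf.
have /ball0_near[r' r'0 r'P] := df.
apply/ball0_near; exists (Num.min r r'); first by rewrite lt_min r0.
move=> v; rewrite lt_min => /andP[vr vr'].
pose g t := f (0 + t *: v) - (2^-1 * 'D_v ('D_v f) 0) * t ^+ 2.
pose dg t := 'D_v f (0 + t *: v) - t * 'D_v ('D_v f) 0.
have tv (t : R) : 0 <= t <= 1 -> `|t *: v| <= `|v|.
  by move=> /andP[t0 t1]; rewrite normrZ ger0_norm // ler_piMl.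
have [t t01 gE] : exists2 s : R, 0 < s < 1 & g 1 - g 0 = dg s.
  apply: mean_value_unit => s s01; apply: is_deriveB.
    by apply: derive_line; rewrite add0r; apply: r'P; apply: (le_lt_trans (tv _ s01)).
  apply: is_derive_eq; rewrite -![_ *: _]/(_ * _); move: ('D_v _ _) => p;
    rewrite mulr1 -mulr2n -mulr_natr; by field.
have {}t01 : 0 <= t <= 1 by case/andP: t01 => *; rewrite !ltW.
have -> : f v - 2^-1 * 'D_v ('D_v f) 0 = dg t.
  by rewrite -gE /g scale1r scale0r !add0r f0 expr1n mulr1 expr0n /= mulr0 subr0 subr0.
have := rP (0 + t *: v) _ v; rewrite add0r Df0 subr0 derive_scale // /dg add0r => H.
apply: (le_trans (H (le_lt_trans (tv _ t01) vr))).
by rewrite expr2 mulrA ler_wpM2r // ler_wpM2l ?tv // ltW.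
Qed.

End Derivative.

(** * Third order jet of a graph preserved by an affine map *)

(** Bundles differentiability with the value of the derivative, so that the
    derivative of a compound expression is assembled along its structure. *)
Definition diff_along (R : realType) (n : nat) (F : 'rV[R]_n -> R^o)
    (x v : 'rV[R]_n) (l : R) : Prop :=
  differentiable F x /\ 'D_v F x = l.

Section DiffAlong.
Variables (R : realType) (n : nat).
Implicit Types (f F G : 'rV[R]_n -> R^o) (u v w x y : 'rV[R]_n).

Lemma diff_along_smooth f x v : smooth_at f x -> diff_along f x v ('D_v f x).
Proof. by move=> /smooth_at_differentiable. Qed.

Lemma diff_alongD F G x v l l' : diff_along F x v l -> diff_along G x v l' ->
  diff_along (fun y => F y + G y) x v (l + l').
Proof.
move=> [dF <-] [dG <-]; split; first exact: differentiableD.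
by rewrite -deriveD //; apply: diff_derivable.
Qed.

Lemma diff_alongM F G x v l l' : diff_along F x v l -> diff_along G x v l' ->
  diff_along (fun y => F y * G y) x v (l * G x + F x * l').
Proof.
move=> [dF <-] [dG <-]; split; first exact: differentiableM.
have := @deriveM R _ F G x v (diff_derivable dF) (diff_derivable dG).
move=> E; apply: (etrans E); rewrite -![_ *: _]/(_ * _).
by rewrite addrC [G x * _]mulrC.
Qed.

Lemma diff_along_cst (k : R) x v : diff_along (fun=> k) x v 0.
Proof. by split; [exact: differentiable_cst|exact: derive_cst]. Qed.

Lemma diff_along_sum (I : Type) (r : seq I) (F : I -> 'rV[R]_n -> R^o) l x v :
  (forall i, diff_along (F i) x v (l i)) ->
  diff_along (fun y => \sum_(i <- r) F i y) x v (\sum_(i <- r) l i).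
Proof.
move=> Fl; elim: r => [|i r IH].
  rewrite big_nil (_ : (fun y => _) = fun=> 0); first exact: diff_along_cst.
  by apply/funext=> y; rewrite big_nil.
rewrite big_cons (_ : (fun y => _) = fun y => F i y + \sum_(i <- r) F i y).
  exact: diff_alongD.
by apply/funext=> y; rewrite big_cons.
Qed.

Lemma diff_along_coord (i : 'I_n) x v :
  diff_along (fun y : 'rV[R]_n => y ord0 i) x v (v ord0 i).
Proof.
split; first exact: differentiable_coord.
apply: cvg_lim => //; apply: (cvg_trans _ (@cvg_cst _ (v ord0 i : R^o) _ (0^')%classic _)).
apply: near_eq_cvg; near=> h.
have h0 : h != 0 by near: h; exact: nbhs_dnbhs_neq.
have E : h^-1 * ((h *: v + x) ord0 i - x ord0 i) = v ord0 i by rewrite !mxE addrK mulKf.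
by first [exact: E|exact: esym E].
Unshelve. all: by end_near. Qed.

Lemma diff_along_linear (c : 'cV[R]_n) x v :
  diff_along (fun y => (y *m c) ord0 ord0) x v ((v *m c) ord0 ord0).
Proof.
rewrite mxE (_ : (fun y => _) = fun y => \sum_j y ord0 j * c j ord0).
  apply: diff_along_sum => i; rewrite -[X in diff_along _ _ _ X]addr0.
  have := diff_alongM (diff_along_coord i x v) (diff_along_cst (c i ord0) x v).
  by rewrite mulr0.
by apply/funext=> y; rewrite mxE.
Qed.

Lemma diff_along_eq F G x v l l' : (\forall y \near x, F y = G y) ->
  diff_along F x v l -> diff_along G x v l' -> l = l'.
Proof. by move=> FG [dF <-] [dG <-]; exact: near_eq_derive. Qed.

End DiffAlong.

(** The hypothesis [invariant] says that the affine map of R^(n+1) with linear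
    part (A, c; b, d) and translation (a, e) preserves the graph of f near 0.
    It is differentiated along one, two, then three directions; at 0 most terms
    vanish with the differential of f. *)
Section Jet.
Variables (R : realType) (n : nat) (f : 'rV[R]_n -> R^o).
Variables (A : 'M[R]_n) (b a : 'rV[R]_n) (c : 'cV[R]_n) (d e : R).
Let phi (w : 'rV[R]_n) := w *m A + f w *: b + a.
Hypothesis f0 : f 0 = 0.
Hypothesis Df0 : forall v, 'D_v f 0 = 0.
Hypothesis smooth0 : \forall x \near (0 : 'rV[R]_n), smooth_at f x.
Hypothesis smootha : \forall x \near (0 : 'rV[R]_n), smooth_at f (phi x).
Hypothesis invariant : \forall x \near (0 : 'rV[R]_n),
  f (phi x) = (x *m c) ord0 ord0 + d * f x + e.

Let phi0 : phi 0 = a. Proof. by rewrite /phi mul0mx f0 scale0r !add0r. Qed.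

Lemma diff_along_phi F x v : smooth_at f x -> smooth_at F (phi x) ->
  diff_along (fun y => F (phi y)) x v
    ('D_(v *m A) F (phi x) + 'D_v f x * 'D_b F (phi x)).
Proof.
move=> /smooth_at_differentiable df /smooth_at_differentiable dF.
by have := derive_comp_affine v df dF.
Qed.

Lemma jet0 : f a = e.
Proof. by have := nbhs_singleton invariant; rewrite phi0 f0 mul0mx mxE mulr0 !add0r. Qed.

Lemma jet1_near w : \forall x \near (0 : 'rV[R]_n),
  'D_(w *m A) f (phi x) + 'D_w f x * 'D_b f (phi x) =
  (w *m c) ord0 ord0 + d * 'D_w f x.
Proof.
near=> x.
have fx : smooth_at f x by near: x.
have fpx : smooth_at f (phi x) by near: x.
have inv : \forall y \near x, f (phi y) = (y *m c) ord0 ord0 + d * f y + e.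
  by near: x; exact: (nbhs_interior invariant).
have := diff_along_eq inv (diff_along_phi w fx fpx)
  (diff_alongD (diff_alongD (diff_along_linear c x w)
    (diff_alongM (diff_along_cst d x w) (diff_along_smooth w fx))) (diff_along_cst e x w)).
by move=> ->; rewrite mul0r add0r addr0.
Unshelve. all: by end_near. Qed.

Lemma jet1 w : 'D_(w *m A) f a = (w *m c) ord0 ord0.
Proof. by have := nbhs_singleton (jet1_near w); rewrite phi0 Df0 mul0r mulr0 !addr0. Qed.

Lemma jet2_near v w : \forall x \near (0 : 'rV[R]_n),
  'D_(v *m A) ('D_(w *m A) f) (phi x) + 'D_v f x * 'D_b ('D_(w *m A) f) (phi x) +
  ('D_v ('D_w f) x * 'D_b f (phi x) +
   'D_w f x * ('D_(v *m A) ('D_b f) (phi x) + 'D_v f x * 'D_b ('D_b f) (phi x))) =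
  d * 'D_v ('D_w f) x.
Proof.
near=> x.
have fx : smooth_at f x by near: x.
have fpx : smooth_at f (phi x) by near: x.
have inv : \forall y \near x, 'D_(w *m A) f (phi y) + 'D_w f y * 'D_b f (phi y) =
  (w *m c) ord0 ord0 + d * 'D_w f y.
  by near: x; exact: (nbhs_interior (jet1_near w)).
have := diff_along_eq inv
  (diff_alongD (diff_along_phi v fx (smooth_at_derive (w *m A) fpx))
     (diff_alongM (diff_along_smooth v (smooth_at_derive w fx))
        (diff_along_phi v fx (smooth_at_derive b fpx))))
  (diff_alongD (diff_along_cst _ x v)
    (diff_alongM (diff_along_cst d x v) (diff_along_smooth v (smooth_at_derive w fx)))).
by move=> ->; rewrite mul0r !add0r.
Unshelve. all: by end_near. Qed.

Lemma jet2 v w :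
  'D_(v *m A) ('D_(w *m A) f) a = (d - 'D_b f a) * 'D_v ('D_w f) 0.
Proof.
have := nbhs_singleton (jet2_near v w); rewrite phi0 (Df0 v) (Df0 w).
move: ('D_b ('D_(w *m A) f) a) ('D_b ('D_b f) a) ('D_(v *m A) ('D_b f) a).
move: ('D_(v *m A) ('D_(w *m A) f) a) ('D_v ('D_w f) 0) ('D_b f a).
move=> p q r p' q' r'; rewrite !(mul0r, addr0) => H.
by rewrite mulrBl -H [r * q]mulrC addrK.
Qed.

(** The products of a second derivative of f at 0 with one at a come from the
    bending of the graph inside phi. Through them the third derivatives detect
    the direction b of the image of the vertical. *)
Lemma jet3 u v w :
  'D_(u *m A) ('D_(v *m A) ('D_(w *m A) f)) a +
  'D_u ('D_v f) 0 * 'D_b ('D_(w *m A) f) a +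
  'D_v ('D_w f) 0 * 'D_(u *m A) ('D_b f) a +
  'D_u ('D_w f) 0 * 'D_(v *m A) ('D_b f) a =
  (d - 'D_b f a) * 'D_u ('D_v ('D_w f)) 0.
Proof.
have fx := nbhs_singleton smooth0.
have fpx := nbhs_singleton smootha.
have D1 := diff_along_phi u fx (smooth_at_derive (v *m A) (smooth_at_derive (w *m A) fpx)).
have D2 := diff_alongM (diff_along_smooth u (smooth_at_derive v fx))
   (diff_along_phi u fx (smooth_at_derive b (smooth_at_derive (w *m A) fpx))).
have D3 := diff_alongM (diff_along_smooth u (smooth_at_derive v (smooth_at_derive w fx)))
   (diff_along_phi u fx (smooth_at_derive b fpx)).
have D4 := diff_alongM (diff_along_smooth u (smooth_at_derive w fx))
   (diff_alongD (diff_along_phi u fx (smooth_at_derive (v *m A) (smooth_at_derive b fpx)))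
     (diff_alongM (diff_along_smooth u (smooth_at_derive v fx))
       (diff_along_phi u fx (smooth_at_derive b (smooth_at_derive b fpx))))).
have := diff_along_eq (jet2_near v w)
  (diff_alongD (diff_alongD D1 D2) (diff_alongD D3 D4))
  (diff_alongM (diff_along_cst d 0 u)
     (diff_along_smooth u (smooth_at_derive v (smooth_at_derive w fx)))).
rewrite phi0 (Df0 u) (Df0 v) (Df0 w).
have alg (x1 x2 x3 x4 x5 x6 x7 x8 x9 z1 z2 z3 z4 z5 z6 z7 z8 : R) :
  x1 + 0 * z1 + (x2 * x3 + 0 * (z2 + 0 * z3)) +
  (x8 * x9 + x4 * (x5 + 0 * z4) + (x6 * (x7 + 0 * z4) +
    0 * (z5 + 0 * z6 + (x2 * z4 + 0 * (z7 + 0 * z8))))) = 0 * x4 + d * x8 ->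
  x1 + x2 * x3 + x4 * x5 + x6 * x7 = (d - x9) * x8.
  by rewrite !(mul0r, addr0, add0r) mulrBl => <-; ring.
exact: alg.
Qed.

End Jet.

(** * Uniform estimates over families of matrices *)

Section MatrixNorm.
Variable R : realType.

Lemma mx_norm_mulmx (p q r : nat) (M : 'M[R]_(p, q)) (N : 'M[R]_(q, r)) :
  `|M *m N| <= q%:R * `|M| * `|N|.
Proof.
apply: mx_norm_le => [|i j]; first by rewrite !mulr_ge0.
rewrite mxE; apply: (le_trans (ler_norm_sum _ _ _)).
have -> : q%:R * `|M| * `|N| = \sum_(k < q) `|M| * `|N|.
  by rewrite sumr_const card_ord -mulrA mulr_natl.
by apply: ler_sum => k _; rewrite normrM ler_pM // mx_entry_le.
Qed.

Lemma mx_norm_tr (p q : nat) (M : 'M[R]_(p, q)) : `|M^T| = `|M|.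
Proof.
have le (k l : nat) (N : 'M[R]_(k, l)) : `|N^T| <= `|N|.
  by apply: mx_norm_le => // i j; rewrite mxE mx_entry_le.
by apply/eqP; rewrite eq_le le -{1}(trmxK M) le.
Qed.

Lemma mx_norm_trace (p : nat) (M : 'M[R]_p) : `|\tr M| <= p%:R * `|M|.
Proof.
rewrite /mxtrace; apply: (le_trans (ler_norm_sum _ _ _)).
have -> : p%:R * `|M| = \sum_(k < p) `|M| by rewrite sumr_const card_ord mulr_natl.
by apply: ler_sum => k _; exact: mx_entry_le.
Qed.

End MatrixNorm.

(** A domination is a big-O whose constant is uniform over the index type. With
    the set of all symmetries under consideration as index type, the constants
    are obtained before any smallness condition is imposed on a symmetry. *)
Section Domination.
Variables (R : realType) (I : Type).

Definition dominated (V : normedModType R) (alpha : I -> R) (F : I -> V) : Prop :=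
  exists K, forall i, `|F i| <= K * alpha i.

Local Notation bounded F := (dominated (fun=> 1) F).

Variable alpha : I -> R.
Hypothesis alpha_ge0 : forall i, 0 <= alpha i.

Lemma dominated_pos (V : normedModType R) (F : I -> V) : dominated alpha F ->
  exists2 K, 0 < K & forall i, `|F i| <= K * alpha i.
Proof.
move=> [K FK]; exists (`|K| + 1) => [|i]; first by rewrite ltr_wpDl.
apply: (le_trans (FK i)); rewrite ler_wpM2r //.
by apply: (le_trans (ler_norm K)); rewrite lerDl.
Qed.

Lemma dominatedD (V : normedModType R) (F G : I -> V) :
  dominated alpha F -> dominated alpha G -> dominated alpha (fun i => F i + G i).
Proof.
move=> [K FK] [L GL]; exists (K + L) => i.
by rewrite mulrDl; apply: (le_trans (ler_normD _ _)); rewrite lerD.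
Qed.

Lemma dominatedN (V : normedModType R) (F : I -> V) :
  dominated alpha F -> dominated alpha (fun i => - F i).
Proof. by move=> [K FK]; exists K => i; rewrite normrN. Qed.

Lemma dominatedB (V : normedModType R) (F G : I -> V) :
  dominated alpha F -> dominated alpha G -> dominated alpha (fun i => F i - G i).
Proof. by move=> hF /dominatedN; exact: dominatedD. Qed.

Lemma dominated_tr (p q : nat) (F : I -> 'M[R]_(p, q)) :
  dominated alpha F -> dominated alpha (fun i => (F i)^T).
Proof. by move=> [K FK]; exists K => i; rewrite mx_norm_tr. Qed.

Lemma dominated_entries (p q : nat) (F : I -> 'M[R]_(p, q)) :
  (forall k l, dominated alpha (fun i => F i k l : R^o)) -> dominated alpha F.
Proof.
move=> FK; pose P k l K := 0 < K /\ forall i, `|F i k l| <= K * alpha i.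
have /choice[K KP] : forall k, exists K : 'I_q -> R, forall l, P k l (K l).
  move=> k; have Hl : forall l, exists K, P k l K.
    by move=> l; have [K K0 KP] := dominated_pos (FK k l); exists K.
  by have [g gP] := choice Hl; exists g.
exists (\sum_k \sum_l K k l) => i.
have K0 k l : 0 <= K k l by case: (KP k l) => /ltW.
apply: mx_norm_le => [|k l]; first by rewrite mulr_ge0 // !sumr_ge0 // => *; rewrite sumr_ge0.
case: (KP k l) => _ /(_ i) /le_trans; apply; rewrite ler_wpM2r //.
rewrite (bigD1 k) //= (bigD1 l) //= -addrA lerDl addr_ge0 // ?sumr_ge0 // => *.
by rewrite sumr_ge0.
Qed.

End Domination.

Notation bounded_family F := (dominated (fun=> 1) F).

Section DominationMul.
Variables (R : realType) (I : Type) (alpha : I -> R).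
Hypothesis alpha_ge0 : forall i, 0 <= alpha i.

Lemma bounded_cst (V : normedModType R) (x : V) : @dominated R I V (fun=> 1) (fun=> x).
Proof. by exists `|x| => i; rewrite mulr1. Qed.

Lemma dominated_mulmx (p q r : nat) (F : I -> 'M[R]_(p, q)) (G : I -> 'M[R]_(q, r)) :
  bounded_family F -> dominated alpha G -> dominated alpha (fun i => F i *m G i).
Proof.
move=> /dominated_pos[|K K0 FK] // /(dominated_pos alpha_ge0)[L L0 GL].
exists (q%:R * K * L) => i; apply: (le_trans (mx_norm_mulmx _ _)).
rewrite -[leRHS]mulrA; apply: ler_pM => //.
by rewrite ler_wpM2l //; have := FK i; rewrite mulr1.
Qed.

Lemma dominated_mulmxl (p q r : nat) (F : I -> 'M[R]_(p, q)) (G : I -> 'M[R]_(q, r)) :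
  dominated alpha F -> bounded_family G -> dominated alpha (fun i => F i *m G i).
Proof.
move=> /dominated_tr hF /dominated_tr hG.
have /dominated_tr := dominated_mulmx hG hF.
by congr dominated; apply/funext=> i; rewrite trmx_mul !trmxK.
Qed.

Lemma dominatedZ (V : normedModType R) (k : I -> R^o) (F : I -> V) :
  bounded_family k -> dominated alpha F -> dominated alpha (fun i => k i *: F i).
Proof.
move=> /dominated_pos[|K K0 kK] // [L FL].
exists (K * L) => i; rewrite normrZ -mulrA; apply: ler_pM => //.
by have := kK i; rewrite mulr1.
Qed.

Lemma dominated_trace (p : nat) (F : I -> 'M[R]_p) : dominated alpha F ->
  dominated alpha (fun i => \tr (F i) : R^o).
Proof.
move=> [K FK]; exists (p%:R * K) => i; apply: (le_trans (mx_norm_trace _)).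
by rewrite -mulrA ler_wpM2l.
Qed.

End DominationMul.

(** The linear form obtained by contracting two arguments of the cubic form T
    with the symmetric tensor J. For T the third derivative of f and J its
    inverse Hessian at a critical point of f, it vanishes exactly when the
    vertical is the affine normal of the graph. *)
Definition trace_form (R : realType) (n : nat) (J : 'M[R]_n) (T : 'I_n -> 'M[R]_n) :
  'cV[R]_n := \col_p \tr (J^T *m T p).

Section Estimate.
Variables (R : realType) (n : nat) (I : Type) (alpha : I -> R).
Hypothesis alpha_ge0 : forall i, 0 <= alpha i.
Variables (A Ha : I -> 'M[R]_n) (b : I -> 'rV[R]_n) (lam : I -> R^o).
Variables (H0 J : 'M[R]_n) (T0 : 'I_n -> 'M[R]_n) (Ta : I -> 'I_n -> 'M[R]_n).
Hypothesis H0J : H0 *m J = 1%:M.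
Hypothesis H0T : H0^T = H0.
Hypothesis alpha_bd : bounded_family (alpha : I -> R^o).
Hypothesis A_bd : bounded_family A.
Hypothesis b_bd : bounded_family b.
Hypothesis lam_bd : bounded_family lam.
Hypothesis lam_ge : forall i, 2^-1 <= lam i.
Hypothesis Ha_near : dominated alpha (fun i => Ha i - H0).
Hypothesis Ta_near : forall p, dominated alpha (fun i => Ta i p - T0 p).
Hypothesis second : forall i, A i *m Ha i *m (A i)^T = lam i *: H0.
Hypothesis third : forall i,
  A i *m (trace_form ((A i)^T *m J *m A i) (Ta i) + (Ha i)^T *m (b i)^T
          + n.+1%:R *: (Ha i *m (b i)^T)) = lam i *: trace_form J T0.

Let eta : 'rV[R]_n := - n.+2%:R^-1 *: (J *m trace_form J T0)^T.
Let M i := (A i)^T *m J *m A i.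

Let bounded_near (p q : nat) (F : I -> 'M[R]_(p, q)) F0 :
  dominated alpha (fun i => F i - F0) -> bounded_family F.
Proof.
move=> /(dominated_pos alpha_ge0)[K K0 FK].
have [L LP] := alpha_bd.
exists (K * L + `|F0|) => i; rewrite mulr1 -[F i](subrK F0).
apply: (le_trans (ler_normD _ _)); rewrite lerD2r; apply: (le_trans (FK i)).
by rewrite ler_pM2l //; have := LP i; rewrite mulr1; apply: le_trans; exact: ler_norm.
Qed.

Let one_ge0 (i : I) : 0 <= (1 : R). Proof. exact: ler01. Qed.

Let M_bd : bounded_family M.
Proof.
apply: dominated_mulmx => //; apply: dominated_mulmx => //; first exact: dominated_tr.
exact: bounded_cst.
Qed.

Let lam_neq0 i : lam i != 0.
Proof. by rewrite gt_eqF // (lt_le_trans _ (lam_ge i)) // invr_gt0. Qed.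

Let M_near : dominated alpha (fun i => M i - lam i *: J).
Proof.
have -> : (fun i => M i - lam i *: J) = (fun i => - (J *m ((Ha i - H0) *m M i))).
  apply/funext=> i.
  have e1 : (lam i)^-1 *: A i *m (Ha i *m (A i)^T *m J) = 1%:M.
    by rewrite -scalemxAl !mulmxA second -scalemxAl H0J scalerA mulVf // scale1r.
  have e2 : Ha i *m M i = lam i *: 1%:M.
    rewrite -(mulmx1C e1) -!scalemxAr scalerA mulfV // scale1r.
    by rewrite /M !mulmxA.
  rewrite mulmxBl e2 mulmxBr mulmxA (mulmx1C H0J) mul1mx -scalemxAr mulmx1.
  by rewrite opprB.
apply: dominatedN; apply: dominated_mulmx => //; first exact: bounded_cst.
by apply: dominated_mulmxl.
Qed.

Let trace_near : dominated alpha
  (fun i => trace_form (M i) (Ta i) - lam i *: trace_form J T0).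
Proof.
apply: dominated_entries => // p j.
have -> : (fun i => (trace_form (M i) (Ta i) - lam i *: trace_form J T0) p j) =
  (fun i => \tr ((M i - lam i *: J)^T *m Ta i p) + lam i *: \tr (J^T *m (Ta i p - T0 p))).
  have trB (X Y T T' : 'M[R]_n) (k : R) : \tr (X^T *m T) - k * \tr (Y^T *m T') =
      \tr ((X - k *: Y)^T *m T) + k * \tr (Y^T *m (T - T')).
    have -> : (X - k *: Y)^T = X^T - k *: Y^T by apply/matrixP=> ? ?; rewrite !mxE.
    rewrite mulmxBr mulmxBl -scalemxAl !raddfB /= mxtraceZ; ring.
  have tfE (X : 'M[R]_n) T : trace_form X T p j = \tr (X^T *m T p) by rewrite mxE.
  apply/funext=> i; rewrite mxE [(- _ : 'cV[R]_n) p j]mxE [(_ *: _ : 'cV[R]_n) p j]mxE !tfE.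
  exact: trB.
have TE p' : bounded_family (fun i => Ta i p') by exact: bounded_near (Ta_near p').
apply: dominatedD.
  by apply: dominated_trace; apply: dominated_mulmxl => //; exact: dominated_tr.
apply: dominatedZ => //; apply: dominated_trace; apply: dominated_mulmx => //.
exact: bounded_cst.
Qed.

(** Here alpha is the norm of a. By [second], the matrix A^T J A is lam J up to
    O(alpha), so that the trace in [third] is lam times the trace at 0 up to
    O(alpha). What remains is a linear equation in b, which is solved by
    lam eta - eta A. *)
Lemma translation_near :
  dominated alpha (fun i => b i - lam i *: eta + eta *m A i).
Proof.
pose v i := b i - lam i *: eta + eta *m A i.
pose t0 := trace_form J T0.
have v_bd : bounded_family v.
  apply: dominatedD; first apply: dominatedB => //.
    by apply: dominatedZ => //; exact: bounded_cst.
  by apply: dominated_mulmx => //; exact: bounded_cst.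
have t0E : t0 = - n.+2%:R *: (H0 *m eta^T).
  rewrite /eta linearZ /= trmxK -scalemxAr mulmxA H0J mul1mx scalerA mulrNN.
  by rewrite mulfV ?scale1r // pnatr_eq0.
have bt : bounded_family (fun i => (b i)^T) by exact: dominated_tr.
have D1 : dominated alpha (fun i => A i *m (H0 *m (v i)^T)).
  pose E1 i := A i *m ((trace_form (M i) (Ta i) - lam i *: t0) + (Ha i - H0)^T *m (b i)^T
     + n.+1%:R *: ((Ha i - H0) *m (b i)^T)).
  pose E2 i := A i *m (Ha i - H0) *m (A i)^T *m eta^T.
  have -> : (fun i => A i *m (H0 *m (v i)^T)) = (fun i => (- n.+2%:R^-1) *: E1 i - E2 i).
    apply/funext=> i; rewrite /E1 /E2 /v.
    have e1 := third i; have e2 := second i.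
    have -> : (trace_form (M i) (Ta i) - lam i *: t0) + (Ha i - H0)^T *m (b i)^T
       + n.+1%:R *: ((Ha i - H0) *m (b i)^T) =
      (trace_form (M i) (Ta i) + (Ha i)^T *m (b i)^T + n.+1%:R *: (Ha i *m (b i)^T))
       - (lam i *: t0 + n.+2%:R *: (H0 *m (b i)^T)).
      have -> : (Ha i - H0)^T = (Ha i)^T - H0 by rewrite -{2}H0T; apply/matrixP=> ? ?;
        rewrite !mxE.
      rewrite !mulmxBl -[n.+2]addn1 natrD.
      have grp (x l p h q : 'cV[R]_n) (k : R) : x - l + (p - h) + k *: (q - h) =
        x + p + k *: q - (l + (k + 1) *: h) by apply/matrixP=> ? ?; rewrite !mxE; ring.
      exact: grp.
    rewrite mulmxBr {}e1 [(_ + _)^T]linearD /= [(_ - _)^T]linearB /= [(_ *: _)^T]linearZ /=.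
    rewrite trmx_mul mulmxBr [A i *m (lam i *: t0 + _)]mulmxDr !mulmxBl e2.
    rewrite mulmxDr mulmxBr mulmxDr mulmxBr t0E -!scalemxAr -!scalemxAl !mulmxA.
    have grp (U W Y N : 'cV[R]_n) (l k : R) : k != 0 -> U - l *: W + Y =
        - k^-1 *: (l *: (- k *: N) - (l *: (- k *: W) + k *: U)) - (l *: N - Y).
      by move=> k0; apply/matrixP=> ? ?; rewrite !mxE; field.
    have := t0E; rewrite /t0 => ->; apply: grp; rewrite pnatr_eq0 //.
  apply: dominatedB.
    apply: dominatedZ; first exact: bounded_cst.
    apply: dominated_mulmx => //; apply: dominatedD; first apply: dominatedD => //.
      by apply: dominated_mulmxl => //; exact: dominated_tr.
    apply: dominatedZ; first exact: bounded_cst.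
    exact: dominated_mulmxl.
  apply: dominated_mulmxl => //; last exact: bounded_cst.
  apply: dominated_mulmxl => //; last exact: dominated_tr.
  exact: dominated_mulmx.
(* A^T J is almost lam times the inverse of A H0, which removes A H0 *)
have D2 : dominated alpha (fun i => lam i *: (v i)^T).
  have -> : (fun i => lam i *: (v i)^T) = (fun i => (A i)^T *m J *m (A i *m (H0 *m (v i)^T))
      - (M i - lam i *: J) *m H0 *m (v i)^T).
    apply/funext=> i; rewrite !mulmxBl -!scalemxAl (mulmx1C H0J) mul1mx /M !mulmxA.
    by rewrite opprB addrC subrK.
  apply: dominatedB.
    apply: dominated_mulmx => //.
    by apply: dominated_mulmx => //; [exact: dominated_tr|exact: bounded_cst].
  apply: dominated_mulmxl => //; last exact: dominated_tr.
  by apply: dominated_mulmxl => //; exact: bounded_cst.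
have D3 : dominated alpha (fun i => (lam i)^-1 *: (lam i *: (v i)^T)).
  apply: dominatedZ => //; exists 2 => i; rewrite mulr1 normfV.
  rewrite -[leRHS]invrK lef_pV2 ?posrE ?normr_gt0 ?lam_neq0 //.
  exact: (le_trans (lam_ge i) (ler_norm _)).
have := dominated_tr D3; congr dominated; apply/funext=> i.
by rewrite scalerA mulVf // scale1r trmxK.
Qed.

End Estimate.

(** * Symmetries carrying the affine normal to itself *)

Section Rigidity.
Variables (R : realType) (n : nat) (f : 'rV[R]_n -> R^o) (r : R).
Hypothesis r0 : 0 < r.
Hypothesis smooth_ball : forall y : 'rV[R]_n, `|y| < r -> smooth_at f y.
Implicit Types (u v w y : 'rV[R]_n).

Local Notation "''e_' i" := (delta_mx ord0 i : 'rV[R]_n) (at level 8, i at level 2,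
  format "''e_' i").

Definition hessian y : 'M[R]_n := \matrix_(i, j) 'D_('e_i) ('D_('e_j) f) y.
Definition third_derivative y (p : 'I_n) : 'M[R]_n :=
  \matrix_(i, j) 'D_('e_p) ('D_('e_i) ('D_('e_j) f)) y.

Lemma near_norm_lt y : `|y| < r -> \forall z \near y, `|z| < r.
Proof.
move=> yr; apply/nbhs_ballP; exists (r - `|y|); first by rewrite /= subr_gt0.
move=> z; rewrite -ball_normE /= distrC => yz.
rewrite -[z](subrK y); apply: (le_lt_trans (ler_normD _ _)).
by rewrite -ltrBrDr.
Qed.

Lemma derive_gradE y v : `|y| < r -> 'D_v f y = \sum_i v ord0 i * 'D_('e_i) f y.
Proof. by move=> /smooth_ball/smooth_at_differentiable; exact: derive_coord. Qed.

Lemma derive2_sumE y u v : `|y| < r -> 'D_u ('D_v f) y =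
  \sum_j v ord0 j * \sum_i u ord0 i * hessian y i j.
Proof.
move=> yr; have fy := smooth_ball yr.
have near1 : \forall z \near y, 'D_v f z = \sum_j v ord0 j * 'D_('e_j) f z.
  by apply: filterS (near_norm_lt yr) => z; exact: derive_gradE.
rewrite (near_eq_derive _ near1).
have [_ ->] : diff_along (fun z => \sum_j v ord0 j * 'D_('e_j) f z) y u
    (\sum_j v ord0 j * 'D_u ('D_('e_j) f) y).
  apply: diff_along_sum => j; have := diff_alongM (diff_along_cst (v ord0 j) y u)
    (diff_along_smooth u (smooth_at_derive 'e_j fy)).
  by rewrite mul0r add0r.
apply: eq_bigr => j _; congr (_ * _).
rewrite (derive_coord u (smooth_at_differentiable (smooth_at_derive _ fy))).
by apply: eq_bigr => i _; rewrite mxE.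
Qed.

Lemma derive2E y u v : `|y| < r ->
  'D_u ('D_v f) y = (u *m hessian y *m v^T) ord0 ord0.
Proof.
move=> yr; rewrite derive2_sumE // mxE; apply: eq_bigr => j _.
by rewrite !mxE mulrC.
Qed.

Lemma derive3E y u v w : `|y| < r -> 'D_u ('D_v ('D_w f)) y =
  \sum_p u ord0 p * (v *m third_derivative y p *m w^T) ord0 ord0.
Proof.
move=> yr; have fy := smooth_ball yr.
have near2 : \forall z \near y, 'D_v ('D_w f) z =
    \sum_j \sum_i w ord0 j * v ord0 i * 'D_('e_i) ('D_('e_j) f) z.
  apply: filterS (near_norm_lt yr) => z zr; rewrite derive2_sumE //.
  apply: eq_bigr => j _; rewrite mulr_sumr; apply: eq_bigr => i _.
  by rewrite mxE mulrA.
rewrite (near_eq_derive _ near2).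
have [_ ->] : diff_along
    (fun z => \sum_j \sum_i w ord0 j * v ord0 i * 'D_('e_i) ('D_('e_j) f) z) y u
    (\sum_j \sum_i w ord0 j * v ord0 i * 'D_u ('D_('e_i) ('D_('e_j) f)) y).
  apply: diff_along_sum => j; apply: diff_along_sum => i.
  have := diff_alongM (diff_along_cst (w ord0 j * v ord0 i) y u)
    (diff_along_smooth u (smooth_at_derive 'e_i (smooth_at_derive 'e_j fy))).
  by rewrite mul0r add0r.
under [RHS]eq_bigr => p _ do rewrite mxE mulr_sumr.
rewrite [RHS]exchange_big; apply: eq_bigr => j _ /=.
under [RHS]eq_bigr => p _ do rewrite mxE mulr_suml mulr_sumr.
rewrite [RHS]exchange_big; apply: eq_bigr => i _ /=.
rewrite (derive_coord u (smooth_at_differentiable (smooth_at_derive _ (smooth_at_derive _ fy)))).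
rewrite mulr_sumr; apply: eq_bigr => p _; rewrite !mxE.
have alg (x1 x2 x3 x4 : R) : x1 * x2 * (x3 * x4) = x3 * (x2 * x4 * x1) by ring.
exact: alg.
Qed.

Hypothesis f0 : f 0 = 0.
Hypothesis Df0 : forall v, 'D_v f 0 = 0.

Let n0 : `|0 : 'rV[R]_n| < r. Proof. by rewrite normr0. Qed.

Lemma hessian0_sym : (hessian 0)^T = hessian 0.
Proof.
apply/matrixP=> i j; rewrite !mxE; apply: second_derivative_symmetric.
  by apply: filterS (near_norm_lt n0) => y /smooth_ball/smooth_at_differentiable.
by move=> w; apply: smooth_at_differentiable; apply: smooth_at_derive; exact: smooth_ball.
Qed.

Section Invariance.
Variables (A : 'M[R]_n) (b a : 'rV[R]_n) (c : 'cV[R]_n) (d e : R) (J : 'M[R]_n).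
Hypothesis a_small : `|a| < r.
Hypothesis invariant : \forall x \near (0 : 'rV[R]_n),
  f (x *m A + f x *: b + a) = (x *m c) ord0 ord0 + d * f x + e.
Hypothesis H0J : hessian 0 *m J = 1%:M.
Let lam := d - 'D_b f a.

Let smooth0 : \forall x \near (0 : 'rV[R]_n), smooth_at f x.
Proof. by apply: filterS (near_norm_lt n0) => y; exact: smooth_ball. Qed.

Let smootha : \forall x \near (0 : 'rV[R]_n), smooth_at f (x *m A + f x *: b + a).
Proof.
have df0 := smooth_at_differentiable (smooth_ball n0).
have [/differentiable_continuous cphi _] := diff_affine_graph A b a 0 df0.
have H : \forall z \near (0 *m A + f 0 *: b + a), `|z| < r.
  by rewrite mul0mx f0 scale0r !add0r; exact: near_norm_lt.
have H2 : \forall x \near (0 : 'rV[R]_n), `|x *m A + f x *: b + a| < r := cphi _ H.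
by apply: filterS H2 => x; exact: smooth_ball.
Qed.

Lemma transform_value : f a = e.
Proof. exact: jet0 f0 invariant. Qed.

Lemma transform_gradient w : 'D_(w *m A) f a = (w *m c) ord0 ord0.
Proof. exact: (jet1 f0 Df0 smooth0 smootha invariant). Qed.

Lemma transform_hessian : A *m hessian a *m A^T = lam *: hessian 0.
Proof.
apply/matrixP=> i j; rewrite [RHS]mxE [hessian 0 i j]mxE.
have := jet2 f0 Df0 smooth0 smootha invariant 'e_i 'e_j; rewrite -/lam => <-.
rewrite derive2E // -!rowE !mxE; apply: eq_bigr => k _; rewrite !mxE; congr (_ * _).
by apply: eq_bigr => l _; rewrite !mxE.
Qed.

(** The contraction with J of the last two directions of [jet3]: of the three
    terms in b, the first and the last give one copy of the Hessian at a (up to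
    transposition) applied to b each, and the middle one gives n copies, n being
    the trace of J H0. *)
Lemma transform_third :
  A *m (trace_form (A^T *m J *m A) (third_derivative a) + (hessian a)^T *m b^T
        + n.+1%:R *: (hessian a *m b^T)) = lam *: trace_form J (third_derivative 0).
Proof.
have JH0 := mulmx1C H0J.
have JT : J^T = J.
  by rewrite -[LHS]mulmx1 -H0J mulmxA -{1}hessian0_sym -trmx_mul H0J trmx1 mul1mx.
apply/matrixP=> k z; rewrite ord1 {z}.
have key i j : J i j * ((lam * third_derivative 0 k i j) : R) = J i j *
   (\sum_p A k p * (row i A *m third_derivative a p *m (row j A)^T) ord0 ord0) +
   J i j * (hessian 0 k i * (b *m hessian a *m (row j A)^T) ord0 ord0) +
   J i j * (hessian 0 i j * (row k A *m hessian a *m b^T) ord0 ord0) +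
   J i j * (hessian 0 k j * (row i A *m hessian a *m b^T) ord0 ord0).
  have := jet3 f0 Df0 smooth0 smootha invariant 'e_k 'e_i 'e_j; rewrite -/lam.
  rewrite -!rowE [third_derivative 0 k i j]mxE [hessian 0 k i]mxE [hessian 0 i j]mxE [hessian 0 k j]mxE => <-.
  rewrite -!mulrDr derive3E // !derive2E //; congr (_ * (_ + _ + _ + _)).
  by apply: eq_bigr => p _; rewrite mxE.
have rowl (p q : nat) (X : 'M[R]_(n, p)) (Y : 'M[R]_(p,
  q)) i z : (row i X *m Y) ord0 z = (X *m Y) i z.
  by rewrite !mxE; apply: eq_bigr => l _; rewrite mxE.
have rowr (p q : nat) (X : 'M[R]_(n, p)) (Y : 'M[R]_(q,
  p)) i z : (Y *m (row i X)^T) z ord0 = (Y *m X^T) z i.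
  by rewrite !mxE; apply: eq_bigr => l _; rewrite !mxE.
have trE (X Y : 'M[R]_n) : \tr (X^T *m Y) = \sum_i \sum_j X i j * Y i j.
  rewrite /mxtrace exchange_big; apply: eq_bigr => i _; rewrite mxE.
  by apply: eq_bigr => j _; rewrite mxE.
have L : (lam *: trace_form J (third_derivative 0)) k ord0 =
  \sum_i \sum_j J i j * (lam * third_derivative 0 k i j).
  rewrite mxE mxE trE mulr_sumr; apply: eq_bigr => i _; rewrite mulr_sumr.
  by apply: eq_bigr => j _; rewrite mulrCA.
rewrite L; under [RHS]eq_bigr => i _ do (under eq_bigr => j _ do rewrite key;
  rewrite !big_split /=).
rewrite !big_split /= mulmxDr mulmxDr.
rewrite [LHS]mxE [X in X + _ = _]mxE -!addrA; congr (_ + (_ + _)).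
- have tfE p : trace_form (A^T *m J *m A) (third_derivative a) p 0 =
      \sum_i \sum_j J i j * (A *m third_derivative a p *m A^T) i j.
    rewrite mxE -trE !trmx_mul trmxK -!mulmxA mxtrace_mulC -!mulmxA.
    by congr (\tr _); rewrite !mulmxA.
  rewrite mxE; under [LHS]eq_bigr => p _ do rewrite tfE mulr_sumr.
  rewrite exchange_big; apply: eq_bigr => i _ /=.
  under eq_bigr => p _ do rewrite mulr_sumr.
  rewrite exchange_big; apply: eq_bigr => j _ /=.
  rewrite mulr_sumr; apply: eq_bigr => p _.
  by rewrite rowr -!mulmxA rowl mulrCA.
- transitivity ((hessian 0 *m J *m (b *m hessian a *m A^T)^T) k ord0).
    by rewrite H0J mul1mx !trmx_mul trmxK mulmxA.
  rewrite -mulmxA mxE; under [LHS]eq_bigr => i _ do rewrite [(J *m _) _ _]mxE mulr_sumr.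
  apply: eq_bigr => i _; apply: eq_bigr => j _.
  by rewrite rowr [_^T j _]mxE mulrCA.
have -> : (A *m (n.+1%:R *: (hessian a *m b^T))) k ord0 =
   n%:R * (A *m hessian a *m b^T) k ord0 + (A *m hessian a *m b^T) k ord0.
  by rewrite -scalemxAr mulmxA mxE -natr1 mulrDl mul1r.
congr (_ + _).
- have -> : (n%:R : R) = \sum_i \sum_j J i j * hessian 0 i j.
    by rewrite -trE JT JH0 mxtrace1.
  rewrite mulr_suml; apply: eq_bigr => i _; rewrite mulr_suml; apply: eq_bigr => j _.
  by rewrite -!mulmxA rowl mulrA.
- transitivity ((hessian 0 *m J *m (A *m hessian a *m b^T)) k ord0).
    by rewrite H0J mul1mx.
  rewrite -mulmxA mxE; under [LHS]eq_bigr => j _ do rewrite [(J *m _) _ _]mxE mulr_sumr.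
  rewrite exchange_big; apply: eq_bigr => i _; apply: eq_bigr => j _.
  by rewrite -!mulmxA rowl -{1}JT [J^T _ _]mxE mulrCA.
Qed.

End Invariance.

Lemma gradient_lipschitz : exists2 G, 0 < G & exists2 e0, 0 < e0 & forall y w,
  `|y| < e0 -> `|'D_w f y| <= G * `|y| * `|w|.
Proof.
have dF j : differentiable ('D_('e_j) f) (0 : 'rV[R]_n).
  by apply: smooth_at_differentiable; apply: smooth_at_derive; exact: smooth_ball.
have [K K0 /ball0_near[e1 e10 KP]] := diff_lipschitz_finite dF.
exists (n.+1%:R * K); first by rewrite mulr_gt0 // ltr0n.
exists (Num.min e1 r); first by rewrite lt_min e10.
move=> y w; rewrite lt_min => /andP[ye yr].
rewrite derive_gradE //; apply: (le_trans (ler_norm_sum _ _ _)).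
have H (i : 'I_n) : true -> `|w ord0 i * 'D_('e_i) f y| <= `|w| * (K * `|y|).
  move=> _; rewrite normrM; apply: ler_pM => //; first exact: mx_entry_le.
  by have := KP y ye i; rewrite Df0 subr0.
apply: (le_trans (ler_sum _ H)); rewrite sumr_const card_ord -[leLHS]mulr_natr.
have alg (p q l m : R) : p * (q * l) * m = m * q * l * p by ring.
by rewrite alg ler_wpM2r // ler_wpM2r // ler_wpM2r ?(ltW K0) // ler_nat leqnSn.
Qed.

Lemma hessian_lipschitz : exists2 K, 0 < K & \forall y \near (0 : 'rV[R]_n),
  `|hessian y - hessian 0| <= K * `|y|.
Proof.
have dF (j : 'I_n * 'I_n) : differentiable ('D_('e_j.1) ('D_('e_j.2) f)) (0 : 'rV[R]_n).
  by apply: smooth_at_differentiable; do 2!apply: smooth_at_derive; exact: smooth_ball.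
have [K K0 KP] := diff_lipschitz_finite dF; exists K => //.
apply: filterS KP => y KP; apply: mx_norm_le; first by rewrite mulr_ge0 // ltW.
by move=> i j; rewrite !mxE; exact: (KP (i, j)).
Qed.

Lemma third_lipschitz : exists2 K, 0 < K & \forall y \near (0 : 'rV[R]_n),
  forall p, `|third_derivative y p - third_derivative 0 p| <= K * `|y|.
Proof.
have dF (j : 'I_n * 'I_n * 'I_n) :
    differentiable ('D_('e_j.1.1) ('D_('e_j.1.2) ('D_('e_j.2) f))) (0 : 'rV[R]_n).
  by apply: smooth_at_differentiable; do 3!apply: smooth_at_derive; exact: smooth_ball.
have [K K0 KP] := diff_lipschitz_finite dF; exists K => //.
apply: filterS KP => y KP p; apply: mx_norm_le; first by rewrite mulr_ge0 // ltW.
by move=> i j; rewrite !mxE; exact: (KP (p, i, j)).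
Qed.

(** The vector (eta, 1) spans the affine normal at 0. If a graph preserving map
    moves the origin only little and takes s (eta, 1) to s' (eta, 1) for small s
    and s', then it fixes the origin: otherwise the affine normals at 0 and at
    (a, f a) would meet at a small height although their directions differ by
    O(|a|). *)
Lemma isotropy_of_normal_line : hessian 0 \in unitmx ->
  exists (eta : 'rV[R]_n) (eps : R), 0 < eps /\
  forall (A : 'M[R]_n) (b a : 'rV[R]_n) (c : 'cV[R]_n) (d e s s' : R),
  `|A| <= 2 -> `|b| <= 1 -> `|a| <= eps -> `|d - 1| <= 4^-1 ->
  s != 0 -> `|s| <= eps -> `|s'| <= eps ->
  (\forall x \near (0 : 'rV[R]_n),
     f (x *m A + f x *: b + a) = (x *m c) ord0 ord0 + d * f x + e) ->
  a + s *: (eta *m A) + s *: b = s' *: eta ->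
  e + s * (eta *m c) ord0 ord0 + s * d = s' ->
  [/\ a = 0, e = 0, c = 0, d = s' / s &
      b = d *: eta - eta *m A /\ A *m hessian 0 *m A^T = d *: hessian 0].
Proof.
move=> H0u; pose H0 := hessian 0; pose J := invmx H0.
have H0J : H0 *m J = 1%:M by exact: mulmxV.
pose eta : 'rV[R]_n := - n.+2%:R^-1 *: (J *m trace_form J (third_derivative 0))^T.
have [G G0 [e1 e10 GP]] := gradient_lipschitz.
have [K2 K20 /ball0_near[e2 e20 K2P]] := hessian_lipschitz.
have [K3 K30 /ball0_near[e3 e30 K3P]] := third_lipschitz.
pose E := `|eta|.
have E0 : 0 <= E by exact: normr_ge0.
have k0 : 0 < (4 * (E + 1))^-1 by rewrite invr_gt0 mulr_gt0 // ltr_wpDl.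
have [e4 e40 fP] : exists2 e4, 0 < e4 & forall y, `|y| < e4 -> `|f y| <=
  (4 * (E + 1))^-1 * `|y|.
  have /ball0_near[e4 e40 H] := diff_first_order k0 (smooth_at_differentiable (smooth_ball n0)).
  by exists e4 => // y /H; rewrite f0 Df0 !subr0.
pose e5 := (4 * G)^-1.
have e50 : 0 < e5 by rewrite invr_gt0 mulr_gt0.
pose e0 := Num.min (Num.min (Num.min e1 e2) (Num.min e3 e4)) (Num.min e5 r).
have e00 : 0 < e0 by rewrite !lt_min e10 e20 e30 e40 e50 r0.
(* the index type of the uniform estimate: a is bounded by a radius e0 that
   does not depend on s and s' *)
pose adm (t : 'M[R]_n * 'rV[R]_n * 'rV[R]_n * R) :=
  let A := t.1.1.1 in let b := t.1.1.2 in let a := t.1.2 in let lam := t.2 in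
  [/\ `|A| <= 2, `|b| <= 1, `|a| < e0, 2^-1 <= lam /\ lam <= 2 &
   A *m hessian a *m A^T = lam *: H0 /\
   A *m (trace_form (A^T *m J *m A) (third_derivative a) + (hessian a)^T *m b^T
        + n.+1%:R *: (hessian a *m b^T)) = lam *: trace_form J (third_derivative 0)].
have [K K0 KP] : exists2 K, 0 < K & forall A b a lam, adm (A, b, a, lam) ->
    `|b - lam *: eta + eta *m A| <= K * `|a|.
  pose I := {t | adm t}.
  pose pA (i : I) := (sval i).1.1.1. pose pb (i : I) := (sval i).1.1.2.
  pose pa (i : I) := (sval i).1.2. pose pl (i : I) : R^o := (sval i).2.
  have alpha_ge0 (i : I) : 0 <= `|pa i| by [].
  have := @translation_near R n I (fun i => `|pa i|) alpha_ge0 pA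
    (fun i => hessian (pa i)) pb pl H0 J (third_derivative 0) (fun i =>
      third_derivative (pa i)) H0J hessian0_sym.
  case.
  - exists e0 => i; have [_ _ ha _ _] := svalP i; rewrite mulr1 normr_id; exact: ltW.
  - by exists 2 => i; have [hA _ _ _ _] := svalP i; rewrite mulr1.
  - by exists 1 => i; have [_ hb _ _ _] := svalP i; rewrite mulr1.
  - exists 2 => i; have [_ _ _ [l1 l2] _] := svalP i; rewrite mulr1 ger0_norm //.
    by apply: le_trans l1; rewrite invr_ge0.
  - by move=> i; have [_ _ _ [l1 l2] _] := svalP i.
  - exists K2 => i; have [_ _ ha _ _] := svalP i; apply: K2P.
    by move: ha; rewrite !lt_min => /andP[/andP[/andP[_ ->] _] _].
  - move=> p; exists K3 => i; have [_ _ ha _ _] := svalP i; apply: K3P.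
    by move: ha; rewrite !lt_min => /andP[/andP[_ /andP[-> _]] _].
  - by move=> i; have [_ _ _ _ []] := svalP i.
  - by move=> i; have [_ _ _ _ []] := svalP i.
  move=> K KP; exists (`|K| + 1) => [|A b a lam tP]; first by rewrite ltr_wpDl.
  have := KP (exist _ (A, b, a, lam) tP); rewrite -/eta => /le_trans; apply.
  by rewrite ler_wpM2r //; apply: (le_trans (ler_norm K)); rewrite lerDl.
pose B := G * E ^+ 2 + G * E + K.
have B0 : 0 < B by apply: ltr_wpDl => //; rewrite addr_ge0 ?mulr_ge0 ?exprn_ge0 ?(ltW G0).
exists eta, (Num.min (e0 / 2) (4 * B)^-1); split.
  by rewrite lt_min divr_gt0 // invr_gt0 mulr_gt0.
move=> A b a c d e s s' hA hb; rewrite !le_min => /andP[ha ha'] hd s0.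
move=> /andP[_ hs] /andP[_ hs'] inv eqi eqii.
have {}ha : `|a| < e0 by apply: (le_lt_trans ha); rewrite ltr_pdivrMr // ltr_pMr // ltr1n.
have := ha; rewrite !lt_min => /andP[/andP[/andP[ha1 ha2] /andP[ha3 ha4]] /andP[ha5 har]].
pose lam := d - 'D_b f a.
have hlam : `|lam - 1| <= 2^-1.
  have -> : lam - 1 = (d - 1) - 'D_b f a by rewrite /lam addrAC.
  apply: (le_trans (ler_normB _ _)).
  have h1 : `|'D_b f a| <= 4^-1.
    apply: (le_trans (GP a b ha1)); apply: (@le_trans _ _ (G * e5 * 1)).
      by apply: ler_pM => //; rewrite ?mulr_ge0 ?(ltW G0) // ler_wpM2l ?(ltW G0) ?(ltW ha5).
    by rewrite /e5 mulr1 invfM mulrCA mulfV ?gt_eqF // mulr1.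
  by apply: (le_trans (lerD hd h1)); lra.
have adm_t : adm (A, b, a, lam).
  rewrite /adm /=; split=> //; first by move: hlam; rewrite ler_norml => /andP[h1 h2];
    split; lra.
  by split; [exact: transform_hessian inv|exact: (transform_third har inv)].
have vle := KP _ _ _ _ adm_t.
set v := b - lam *: eta + eta *m A in vle.
have c_E w : 'D_(w *m A) f a = (w *m c) ord0 ord0 by exact: (transform_gradient har inv).
have e_E : f a = e := transform_value inv.
(* both terms are small compared to a: the first one because s' - s lam is
   O(|a|) with a small constant, the second one because v = O(|a|) and s is
   small *)
have aE : a = (s' - s * lam) *: eta - s *: v.
  rewrite scalerBl -eqi /v; move: (eta *m A) => q.
  by apply/matrixP=> i j; rewrite !mxE; ring.
have dfa := smooth_at_differentiable (smooth_ball har).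
have sE : s' - s * lam = f a + s' * 'D_eta f a - 'D_a f a.
  have : 'D_(s *: (eta *m A) + s *: b + a) f a = 'D_(s' *: eta) f a.
    by congr ('D__ f a); rewrite -eqi addrC addrA.
  rewrite (derive_add _ _ dfa) (derive_add _ _ dfa) !(derive_scale _ _ dfa) => H.
  rewrite -H c_E e_E -eqii /lam.
  have alg (x1 x2 x3 x4 x5 x6 : R) : x1 + x2 * x3 + x2 * x4 - x2 * (x4 - x5) =
    x1 + (x2 * x3 + x2 * x5 + x6) - x6 by ring.
  exact: alg.
have a_eq0 : a = 0.
  pose al := `|a|.
  have al0 : 0 <= al by exact: normr_ge0.
  pose q := (4 * B)^-1.
  have q0 : 0 < q by rewrite invr_gt0 mulr_gt0.
  have qB : q * B = 4^-1 by rewrite /q invfM -mulrA mulVf ?gt_eqF // mulr1.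
  have b1 : `|s' - s * lam| <= (4 * (E + 1))^-1 * al + q * (G * al * E) + G * al * q.
    rewrite sE; apply: (le_trans (ler_normB _ _)); apply: lerD.
      apply: (le_trans (ler_normD _ _)); apply: lerD; first exact: fP.
      by rewrite normrM; apply: ler_pM => //; exact: GP.
    apply: (le_trans (GP a a ha1)).
    by rewrite ler_wpM2l // mulr_ge0 // ltW.
  have b2 : al <= ((4 * (E + 1))^-1 * al + q * (G * al * E) + G * al * q) * E + q * (K * al).
    rewrite /al {1}aE; apply: (le_trans (ler_normB _ _));
      rewrite [`|_ *: eta|]normrZ [`|s *: v|]normrZ; apply: lerD.
      exact: (ler_wpM2r E0 b1).
    by apply: ler_pM.
  have kE : (4 * (E + 1))^-1 * E <= 4^-1.
    rewrite invfM -mulrA ler_piMr ?invr_ge0 // mulrC ler_pdivrMr ?mul1r ?lerDl //.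
    by rewrite ltr_wpDl.
  have b3 : al <= al * (4^-1 + 4^-1).
    apply: (le_trans b2); rewrite -{2}qB.
    have -> : ((4 * (E + 1))^-1 * al + q * (G * al * E) + G * al * q) * E + q * (K * al) =
      al * ((4 * (E + 1))^-1 * E + q * B) by rewrite /B; ring.
    by rewrite ler_wpM2l // lerD2r.
  apply/eqP; rewrite -normr_le0 -/al; move: b3; lra.
have lamE : lam = d by rewrite /lam a_eq0 Df0 subr0.
have v0 : v = 0.
  by apply/eqP; rewrite -normr_le0; apply: (le_trans vle); rewrite a_eq0 normr0 mulr0.
have sd : s' - s * d = 0.
  by rewrite -lamE sE a_eq0 f0 !Df0 mulr0 addr0 subr0.
split=> //; first by rewrite -e_E a_eq0.
- apply/matrixP=> i j; rewrite mxE ord1.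
  have := c_E 'e_i; rewrite a_eq0 Df0 -rowE mxE => <- //.
- by move/eqP: sd; rewrite subr_eq0 => /eqP ->; rewrite [s * d]mulrC mulfK.
split.
  by move/eqP: v0; rewrite /v lamE addrAC subr_eq0 => /eqP <-; rewrite addrK.
by have := transform_hessian har inv; rewrite -/lam lamE a_eq0.
Qed.

End Rigidity.

(** * Contractions of a graph *)

Section Contraction.
Variables (R : realType) (n : nat) (f : 'rV[R]_n -> R) (H0 P A : 'M[R]_n) (sg d : R)
  (eta b : 'rV[R]_n).
Implicit Types (u v w y : 'rV[R]_n).

Definition bform (H : 'M[R]_n) u v : R := (u *m H *m v^T) ord0 ord0.
Definition sqnorm w : R := \sum_i w ord0 i ^+ 2.

Lemma sqnorm_ge0 w : 0 <= sqnorm w.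
Proof. by apply: sumr_ge0 => i _; exact: sqr_ge0. Qed.

Lemma norm_le_sqnorm w : `|w| ^+ 2 <= sqnorm w.
Proof.
rewrite -[leRHS]sqr_sqrtr ?sqnorm_ge0 // lerXn2r ?nnegrE ?sqrtr_ge0 //.
apply: mx_norm_le => [|i j]; first exact: sqrtr_ge0.
rewrite ord1 -sqrtr_sqr ler_wsqrtr // /sqnorm (bigD1 j) //= lerDl.
by apply: sumr_ge0 => k _; exact: sqr_ge0.
Qed.

Lemma sqnorm_le_norm w : sqnorm w <= n%:R * `|w| ^+ 2.
Proof.
have H (i : 'I_n) : true -> w ord0 i ^+ 2 <= `|w| ^+ 2.
  by move=> _; rewrite -[leLHS]real_normK ?num_real // lerXn2r ?nnegrE // mx_entry_le.
by apply: (le_trans (ler_sum _ H)); rewrite sumr_const card_ord mulr_natl.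
Qed.

Lemma bform_norm (H : 'M[R]_n) u v : `|bform H u v| <= (n%:R * (n%:R * `|H|)) * `|u| * `|v|.
Proof.
apply: (le_trans (mx_entry_le _ _ _)); apply: (le_trans (mx_norm_mulmx _ _)).
have -> : n%:R * (n%:R * `|H|) * `|u| * `|v| = n%:R * (n%:R * `|u| * `|H|) * `|v| by ring.
by rewrite mx_norm_tr ler_wpM2r // ler_wpM2l // mx_norm_mulmx.
Qed.

Lemma bformZl (H : 'M[R]_n) (k : R) u v : bform H (k *: u) v = k * bform H u v.
Proof. by rewrite /bform -!scalemxAl mxE. Qed.
Lemma bformZr (H : 'M[R]_n) (k : R) u v : bform H u (k *: v) = k * bform H u v.
Proof. by rewrite /bform linearZ /= -scalemxAr mxE. Qed.
Lemma bformBl (H : 'M[R]_n) u u' v : bform H (u - u') v = bform H u v - bform H u' v.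
Proof. by rewrite /bform !mulmxBl !mxE. Qed.
Lemma bformBr (H : 'M[R]_n) u v v' : bform H u (v - v') = bform H u v - bform H u v'.
Proof. by rewrite /bform linearB /= mulmxBr !mxE. Qed.

(* P diagonalizes H0, hence gives a norm, equivalent to the maximum norm, whose
   square is multiplied by d under A; W is the projection of the graph to the
   first coordinates along (eta, 1), for which the map becomes linear *)
Hypothesis Pu : P \in unitmx.
Hypothesis H0P : H0 = sg *: (P *m P^T).
Hypothesis sg2 : sg ^+ 2 = 1.
Hypothesis AH : A *m H0 *m A^T = d *: H0.
Hypothesis d01 : 0 < d < 1.
Hypothesis bE : b = d *: eta - eta *m A.
Hypothesis f_small : forall e : R, 0 < e -> \forall v \near (0 : 'rV[R]_n), `|f v| <= e * `|v|.
Hypothesis f_taylor : forall e : R, 0 < e ->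
  \forall v \near (0 : 'rV[R]_n), `|f v - 2^-1 * bform H0 v v| <= e * `|v| ^+ 2.
Hypothesis f_inv : \forall v \near (0 : 'rV[R]_n), f (v *m A + f v *: b) = d * f v.

Let W v := v - f v *: eta.
Let phi v := v *m A + f v *: b.
Let N w := sqnorm (w *m P).

Lemma bform_sqnorm w : bform H0 w w = sg * sqnorm (w *m P).
Proof.
rewrite /bform H0P -scalemxAr -scalemxAl mxE; congr (_ * _).
rewrite !mulmxA -[w *m P *m P^T *m _]mulmxA -trmx_mul mxE.
by apply: eq_bigr => i _; rewrite [_^T _ _]mxE expr2.
Qed.

Let sg_neq0 : sg != 0.
Proof. by apply/eqP => s0; move/eqP: sg2; rewrite s0 expr0n /= eq_sym oner_eq0. Qed.

Let NA w : N (w *m A) = d * N w.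
Proof.
apply: (mulfI sg_neq0); rewrite -bform_sqnorm mulrCA -bform_sqnorm.
rewrite /bform trmx_mul -[d * _]/(d * _).
have -> : w *m A *m H0 *m (A^T *m w^T) = w *m (A *m H0 *m A^T) *m w^T by rewrite !mulmxA.
by rewrite AH -scalemxAr -scalemxAl mxE.
Qed.

Let W_phi v : f (phi v) = d * f v -> W (phi v) = W v *m A.
Proof.
move=> e; rewrite /W e /phi bE mulmxBl -scalemxAl.
by move: (v *m A) (eta *m A) => p q; apply/matrixP=> i j; rewrite !mxE; ring.
Qed.

Let C := (n%:R * `|invmx P|) ^+ 2 + 1.
Let C0 : 0 < C. Proof. by rewrite ltr_wpDl // sqr_ge0. Qed.

Let normN w : `|w| ^+ 2 <= C * N w.
Proof.
have -> : `|w| ^+ 2 = `|w *m P *m invmx P| ^+ 2 by rewrite mulmxK.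
apply: (@le_trans _ _ ((n%:R * `|w *m P| * `|invmx P|) ^+ 2)).
  by rewrite lerXn2r ?nnegrE // ?mulr_ge0 //; exact: mx_norm_mulmx.
have -> : (n%:R * `|w *m P| * `|invmx P|) ^+ 2 =
  (n%:R * `|invmx P|) ^+ 2 * `|w *m P| ^+ 2 by ring.
by apply: ler_pM; rewrite ?sqr_ge0 ?norm_le_sqnorm // lerDl.
Qed.

Let normW v : `|f v| <= (2 * (`|eta| + 1))^-1 * `|v| -> `|v| <= 2 * `|W v| /\ `|W v| <=
  2 * `|v|.
Proof.
move=> fv.
have h : `|f v *: eta| <= 2^-1 * `|v|.
  rewrite normrZ; apply: (le_trans (ler_wpM2r (normr_ge0 _) fv)).
  rewrite invfM mulrAC -!mulrA ler_wpM2l ?invr_ge0 // mulrA ler_piMl //.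
  by rewrite ler_pdivrMl ?mulr1 ?lerDl // ltr_wpDl.
split.
  have : `|v| <= `|W v| + `|f v *: eta| by rewrite -{1}[v](subrK (f v *: eta)) ler_normD.
  by move: h; set x := `|v|; set y := `|W v|; set z := `|_ *: _|; move=> *; lra.
have : `|W v| <= `|v| + `|f v *: eta| by exact: ler_normB.
by have := normr_ge0 v; move: h; set x := `|v|; set y := `|W v|; set z := `|_ *: _|;
  move=> *; lra.
Qed.

Let taylorW (e : R) : 0 < e ->
  \forall v \near (0 : 'rV[R]_n), `|f v - 2^-1 * bform H0 (W v) (W v)| <= e * `|v| ^+ 2.
Proof.
move=> e0; pose K := n%:R * (n%:R * `|H0|); pose E := `|eta|.
have K0 : 0 <= K by rewrite !mulr_ge0.
have E0 : 0 <= E by exact: normr_ge0.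
pose B := 2 * K * E + K * E ^+ 2 + 1.
have B0 : 0 < B by apply: ltr_wpDl => //; rewrite addr_ge0 // ?mulr_ge0 // exprn_ge0.
pose k := Num.min 1 (e / B).
have k0 : 0 < k by rewrite lt_min ltr01 divr_gt0.
have k1 : k <= 1 by rewrite ge_min lexx.
have kB : k * B <= e by rewrite -ler_pdivlMr // ge_min lexx orbT.
have e2 : 0 < e / 2 by rewrite divr_gt0.
near=> v.
have h1 : `|f v| <= k * `|v| by near: v; exact: f_small.
have h2 : `|f v - 2^-1 * bform H0 v v| <= e / 2 * `|v| ^+ 2 by near: v; exact: f_taylor.
have -> : f v - 2^-1 * bform H0 (W v) (W v) = (f v - 2^-1 * bform H0 v v) +
   2^-1 * (f v * bform H0 v eta + f v * bform H0 eta v - f v * (f v * bform H0 eta eta)).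
  by rewrite /W bformBl !bformBr !bformZl !bformZr; ring.
apply: (le_trans (ler_normD _ _)).
have -> : e * `|v| ^+ 2 = e / 2 * `|v| ^+ 2 + 2^-1 * (e * `|v| ^+ 2) by field.
apply: lerD => //.
rewrite normrM ger0_norm ?invr_ge0 // ler_wpM2l ?invr_ge0 //.
have hh (u w : 'rV[R]_n) : `|bform H0 u w| <= K * `|u| * `|w| by exact: bform_norm.
have fv2 : `|f v| * `|f v| <= k * `|v| * (k * `|v|) by apply: ler_pM.
have b1 : `|f v * bform H0 v eta| <= k * `|v| * (K * `|v| * E) by rewrite normrM;
  apply: ler_pM.
have b2 : `|f v * bform H0 eta v| <= k * `|v| * (K * E * `|v|) by rewrite normrM;
  apply: ler_pM.
have b3 : `|f v * (f v * bform H0 eta eta)| <= k * `|v| * (k * `|v|) * (K * E * E).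
  by rewrite !normrM mulrA; apply: ler_pM; rewrite ?mulr_ge0.
apply: (le_trans (ler_normB _ _)).
apply: (le_trans (lerD (le_trans (ler_normD _ _) (lerD b1 b2)) b3)).
have -> : k * `|v| * (K * `|v| * E) + k * `|v| * (K * E * `|v|) + k * `|v| * (k * `|v|) * (K * E * E)
  = k * (2 * K * E + k * (K * E ^+ 2)) * `|v| ^+ 2 by ring.
rewrite ler_wpM2r ?sqr_ge0 //; apply: le_trans kB; rewrite ler_wpM2l ?(ltW k0) //.
rewrite /B -addrA lerD2l; apply: (@le_trans _ _ (1 * (K * E ^+ 2))).
  by rewrite ler_wpM2r // mulr_ge0 // sqr_ge0.
by rewrite mul1r lerDl.
Unshelve. all: by end_near. Qed.

(** Along the orbit of y under phi, the norm of W and the value of f are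
    governed by d: both sides of the equation are multiplied by d at each step,
    and their difference is o(|y_k|^2) = o(d^k). *)
Lemma invariant_graph_quadric :
  \forall y \near (0 : 'rV[R]_n), f y = 2^-1 * bform H0 (W y) (W y).
Proof.
have k0 : 0 < (2 * (`|eta| + 1))^-1 by rewrite invr_gt0 mulr_gt0 // ltr_wpDl.
have /ball0_near[r1 r10 r1P] := f_inv.
have /ball0_near[r2 r20 r2P] := f_small k0.
have /ball0_near[r3 r30 r3P] := f_small ltr01.
pose rho1 := Num.min r1 (Num.min r2 r3).
have rho10 : 0 < rho1 by rewrite !lt_min r10 r20.
pose L := n%:R * `|A| + `|b| + 1.
have L0 : 0 < L by rewrite ltr_wpDl // addr_ge0 // mulr_ge0.
have L1 : 1 <= L by rewrite lerDr addr_ge0 // mulr_ge0.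
pose rho2 := rho1 / L.
have rho20 : 0 < rho2 by rewrite divr_gt0.
have rho21 : rho2 <= rho1 by rewrite ler_pdivrMr // ler_peMr // ltW.
pose S v := `|v| < rho2 /\ 4 * (C * N (W v)) < rho2 ^+ 2.
have [d0 d1] := andP d01.
(* S is stable under phi: the bound on N (W v) is preserved by the contraction
   and controls |phi v| as soon as phi v is in the larger ball of radius rho1 *)
have step v : S v -> [/\ S (phi v), f (phi v) = d * f v, N (W (phi v)) = d * N (W v)
    & `|v| ^+ 2 <= 4 * (C * N (W v))].
  have two v' : `|v'| < rho1 -> `|v'| ^+ 2 <= 4 * (C * N (W v')).
    rewrite !lt_min => /and3P[_ h _]; have [le1 _] := normW (r2P _ h).
    apply: (@le_trans _ _ ((2 * `|W v'|) ^+ 2)); first by rewrite lerXn2r ?nnegrE ?mulr_ge0.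
    by rewrite exprMn -natrX ler_wpM2l.
  move=> [v1 v2]; have vr : `|v| < rho1 by exact: lt_le_trans rho21.
  have := vr; rewrite !lt_min => /and3P[vr1 vr2 vr3].
  have fe : f (phi v) = d * f v by exact: r1P.
  have NE : N (W (phi v)) = d * N (W v) by rewrite W_phi // NA.
  have pr : `|phi v| < rho1.
    apply: (@le_lt_trans _ _ (L * `|v|)); last by rewrite mulrC -ltr_pdivlMr.
    apply: (le_trans (ler_normD _ _)); rewrite /L -addrA mulrDl; apply: lerD.
      by apply: (le_trans (mx_norm_mulmx _ _)); rewrite mulrAC.
    rewrite normrZ mulrDl mul1r; apply: (@le_trans _ _ (`|b| * `|v|)); last by rewrite lerDl.
    by rewrite mulrC ler_wpM2l //; have := r3P _ vr3; rewrite mul1r.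
  have Nlt : 4 * (C * N (W (phi v))) < rho2 ^+ 2.
    apply: (le_lt_trans _ v2); rewrite NE ler_wpM2l // ler_wpM2l ?(ltW C0) //.
    by rewrite ler_piMl ?sqnorm_ge0 // ltW.
  split => //; last exact: two.
  split => //; rewrite -(ltr_pXn2r (isT : (0 < 2)%N)) ?nnegrE ?(ltW rho20) //.
  exact: (le_lt_trans (two _ pr)).
have iterS v k : S v -> [/\ S (iter k phi v), f (iter k phi v) = d ^+ k * f v
    & N (W (iter k phi v)) = d ^+ k * N (W v)].
  move=> Sv; elim: k => [|k [IH1 IH2 IH3]]; first by rewrite expr0 !mul1r.
  by have [s1 s2 s3 _] := step _ IH1; split => //=; rewrite ?s2 ?s3 ?IH2 ?IH3 mulrA exprS.
have main v : S v -> f v = 2^-1 * bform H0 (W v) (W v).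
  move=> Sv; pose X := 4 * (C * N (W v)).
  have X0 : 0 <= X by rewrite !mulr_ge0 ?sqnorm_ge0 // ltW.
  apply/eqP; rewrite -subr_eq0 -normr_le0; apply/ler_addgt0Pl => e e0; rewrite addr0.
  have e'0 : 0 < e / (X + 1) by rewrite divr_gt0 // ltr_wpDl.
  have /ball0_near[dl dl0 dlP] := taylorW e'0.
  have [k kP] : exists k, d ^+ k * X < dl ^+ 2.
    have X10 : 0 < X + 1 by rewrite ltr_wpDl.
    have /cvg_expr/cvgrPdist_lt : `|d| < 1 by rewrite gtr0_norm.
    move=> /(_ (dl ^+ 2 / (X + 1))); rewrite divr_gt0 ?exprn_gt0 // => /(_ isT) [k _ kP].
    exists k; have := kP k (leqnn k).
    rewrite sub0r normrN gtr0_norm ?exprn_gt0 // ltr_pdivlMr //.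
    by apply: le_lt_trans; rewrite ler_wpM2l ?lerDl // exprn_ge0 // ltW.
  have [s1 s2 s3] := iterS v k Sv.
  have [_ _ _] := step _ s1; rewrite s3 => yk.
  have yk2 : `|iter k phi v| ^+ 2 <= d ^+ k * X.
    by apply: (le_trans yk); rewrite /X; have -> : 4 * (C * (d ^+ k * N (W v))) =
      d ^+ k * (4 * (C * N (W v))) by ring.
  have ykd : `|iter k phi v| < dl.
    rewrite -(ltr_pXn2r (isT : (0 < 2)%N)) ?nnegrE ?(ltW dl0) //.
    exact: (le_lt_trans yk2).
  have := dlP _ ykd; rewrite bform_sqnorm -/(N _) s3 s2 bform_sqnorm -/(N _).
  have dk : 0 < d ^+ k by rewrite exprn_gt0.
  have -> : d ^+ k * f v - 2^-1 * (sg * (d ^+ k * N (W v))) =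
    d ^+ k * (f v - 2^-1 * (sg * N (W v))) by ring.
  rewrite normrM gtr0_norm // => h.
  have h2 := le_trans h (ler_wpM2l (ltW e'0) yk2).
  rewrite -(ler_pM2l dk); apply: (le_trans h2).
  rewrite mulrCA ler_pM2l // mulrAC ler_pdivrMr ?ltr_wpDl //.
  by rewrite ler_wpM2l ?(ltW e0) // lerDl.
have [K KP] : exists K, 0 < K /\ forall v, `|v| < rho1 -> 4 * (C * N (W v)) <= K * `|v| ^+ 2.
  exists (4 * (C * (n%:R * ((n%:R * `|P|) ^+ 2 * 4))) + 1); split.
    by rewrite ltr_wpDl // !mulr_ge0 ?sqr_ge0 // ltW.
  move=> v; rewrite !lt_min => /and3P[_ h _]; have [_ le2] := normW (r2P _ h).
  apply: (@le_trans _ _ (4 * (C * (n%:R * ((n%:R * `|P|) ^+ 2 * 4))) * `|v| ^+ 2)).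
  2: by rewrite ler_wpM2r ?sqr_ge0 // lerDl.
  rewrite -!mulrA ler_wpM2l // ler_wpM2l ?(ltW C0) //.
  apply: (le_trans (sqnorm_le_norm _)); rewrite ler_wpM2l //.
  apply: (@le_trans _ _ ((n%:R * (2 * `|v|) * `|P|) ^+ 2)).
    rewrite lerXn2r ?nnegrE ?mulr_ge0 //; apply: (le_trans (mx_norm_mulmx _ _)).
    by rewrite ler_wpM2r // ler_wpM2l.
  by rewrite le_eqVlt; apply/orP; left; apply/eqP; ring.
case: KP => K0 KP.
apply/ball0_near; exists (Num.min rho2 (rho2 / (K + 1))).
  by rewrite lt_min rho20 divr_gt0 // addr_gt0.
move=> v; rewrite lt_min => /andP[v1 v2]; apply: main; split => //.
apply: (le_lt_trans (KP _ (lt_le_trans v1 rho21))).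
have K10 : 0 < K + 1 by rewrite addr_gt0.
move: v2; rewrite ltr_pdivlMr // => v2.
apply: (@le_lt_trans _ _ ((`|v| * (K + 1)) ^+ 2)).
  rewrite exprMn mulrC ler_wpM2l ?sqr_ge0 //.
  have -> : (K + 1) ^+ 2 = K + (K ^+ 2 + K + 1) by ring.
  by rewrite lerDl !addr_ge0 ?sqr_ge0 ?(ltW K0).
rewrite ltr_pXn2r // nnegrE; first by rewrite mulr_ge0 // ltW.
exact: ltW.
Qed.

End Contraction.

(** * Symmetries close to the identity *)

Section AffineGroup.
Variables (R : realType) (m : nat).
Implicit Types (M : 'M[R]_m) (c x : 'rV[R]_m) (Omega : set 'rV[R]_m).

Definition affine_map M c x := x *m M + c.

Lemma affine_mapK M c : M \in unitmx ->
  cancel (affine_map M c) (affine_map (invmx M) (- c *m invmx M)).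
Proof. by move=> Mu x; rewrite /affine_map mulNmx mulmxDl addrK mulmxK. Qed.

Lemma affine_mapVK M c : M \in unitmx ->
  cancel (affine_map (invmx M) (- c *m invmx M)) (affine_map M c).
Proof. by move=> Mu x; rewrite /affine_map mulNmx mulmxBl !mulmxKV // subrK. Qed.

Lemma affine_map_comp M c M' c' x :
  affine_map M' c' (affine_map M c x) = affine_map (M *m M') (c *m M' + c') x.
Proof. by rewrite /affine_map mulmxDl addrA mulmxA. Qed.

(** Unlike [affine_symmetry], this form keeps track of the matrix and of the
    translation, in which closeness to the identity is measured. *)
Definition matrix_symmetry Omega M c :=
  M \in unitmx /\ forall x, Omega (affine_map M c x) <-> Omega x.

Lemma affine_symmetryP Omega (g : 'rV[R]_m -> 'rV[R]_m) : affine_symmetry Omega g ->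
  exists M c, matrix_symmetry Omega M c /\ g = affine_map M c.
Proof.
move=> [[M [c [Mu gE]]] gO]; have {}gE : g = affine_map M c by apply/funext.
exists M, c; split => //; split => // x; rewrite -gE; split; last first.
  by move=> Ox; rewrite -gO; exists x.
rewrite -{1}gO => -[y Oy]; rewrite gE => /(can_inj (affine_mapK c Mu)) <- //.
Qed.

Lemma matrix_symmetryV Omega M c : matrix_symmetry Omega M c ->
  matrix_symmetry Omega (invmx M) (- c *m invmx M).
Proof.
move=> [Mu H]; split; first by rewrite unitmx_inv.
by move=> x; rewrite -H affine_mapVK.
Qed.

Lemma matrix_symmetry_comp Omega M c M' c' :
  matrix_symmetry Omega M c -> matrix_symmetry Omega M' c' ->
  matrix_symmetry Omega (M *m M') (c *m M' + c').
Proof.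
move=> [Mu H] [Mu' H']; split; first by rewrite unitmx_mul Mu.
by move=> x; rewrite -affine_map_comp H' H.
Qed.

End AffineGroup.

Section Pigeonhole.
Variables (R : realType) (m : nat).

(** An interval is uncountable, since countable sets have measure zero. *)
Lemma interval_uncountable_collision (T : countType) (h : R -> T) (e : R) : 0 < e ->
  exists s t, [/\ 0 < s < e, 0 < t < e, s < t & h s = h t].
Proof.
move=> e0; apply: contrapT => no.
have cnt : countable (`]0, e[%classic : set R).
  apply/countable_injP; exists (pickle \o h) => s t.
  rewrite !inE /= !in_itv /= => s0 t0 /(pcan_inj pickleK) hst.
  by case: (ltgtP s t) => // lt; exfalso; apply: no; [exists s, t|exists t, s].
have := countable_lebesgue_measure0 cnt.
by rewrite lebesgue_measure_itv /= lte_fin e0 oppr0 adde0 => -[] e00; move: e0;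
  rewrite e00 ltxx.
Qed.

Lemma floor_eq_close (N x y : R) : 0 < N -> Num.floor (x * N) = Num.floor (y * N) ->
  `|x - y| <= N^-1.
Proof.
move=> N0 fe; have := floor_le (x * N); have := floor_le (y * N).
have := floorD1_gt (x * N); have := floorD1_gt (y * N); rewrite fe intrD.
move: (_%:~R) => k h1 h2 h3 h4.
rewrite -[leRHS]mul1r ler_pdivlMr // -[X in _ * X](gtr0_norm N0) -normrM mulrBl ler_norml.
by apply/andP; split; move: h1 h2 h3 h4; lra.
Qed.

(** For t in an interval, choose a symmetry taking X to X + t xi. The affine
    group is covered by countably many small pieces, so that two of these
    symmetries lie in the same piece; composing one with the inverse of the
    other gives a symmetry close to the identity. *)
Lemma small_symmetry (Omega : set 'rV[R]_m) (X xi : 'rV[R]_m) (e : R) :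
  open Omega -> affinely_homogeneous Omega -> Omega X -> 0 < e ->
  exists s t : R, exists (M : 'M[R]_m) (c : 'rV[R]_m),
    [/\ 0 < s < e, 0 < t < e, s < t, matrix_symmetry Omega M c &
     [/\ affine_map M c (X + t *: xi) = X + s *: xi,
        `|M - 1%:M| <= e & `|c| <= e]].
Proof.
move=> oO homO OX e0.
have [e1 e10 e1P] : exists2 e1, 0 < e1 & forall s, `|s| < e1 -> Omega (X + s *: xi).
  have : \forall s \near (0 : R), Omega (X + s *: xi).
    have cont : {for (0 : R), continuous (fun s : R => X + s *: xi)}.
      have dv : differentiable (fun s : R => s *: xi) (0 : R) by exact: differentiableZl.
      exact: (differentiable_continuous (differentiableD (differentiable_cst X (0 : R)) dv)).
    apply: cont; rewrite /= scale0r addr0; exact: open_nbhs_nbhs.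
  by move/nbhs_norm0P => [e1 e10 H]; exists e1.
pose mk (k : nat) : R := m%:R * k%:R.
(* a piece consists of the symmetries whose inverse matrix and translation are
   bounded by k and whose coefficients lie in a given cube of side 1 / N k *)
pose N k : R := (1 + mk k + mk k ^+ 2) / e.
have mk0 k : 0 <= mk k by rewrite mulr_ge0.
have N0 k : 0 < N k by rewrite divr_gt0 // -addrA ltr_pwDl // addr_ge0 // sqr_ge0.
have [kf kfP] : exists kf : 'M[R]_m * 'rV[R]_m -> nat, forall t,
    `|invmx t.1| <= (kf t)%:R /\ `|t.2| <= (kf t)%:R.
  exists (fun t => Num.bound (Num.max `|invmx t.1| `|t.2|)) => t.
  by apply/andP; rewrite -ge_max; apply: ltW; apply: archi_boundP; rewrite le_max normr_ge0.
pose code (t : 'M[R]_m * 'rV[R]_m) : nat * 'M[int]_m * 'rV[int]_m :=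
  (kf t, map_mx (fun x => Num.floor (x * N (kf t))) t.1,
   map_mx (fun x => Num.floor (x * N (kf t))) t.2).
have choose s : exists t : 'M[R]_m * 'rV[R]_m, `|s| < e1 ->
    matrix_symmetry Omega t.1 t.2 /\ affine_map t.1 t.2 X = X + s *: xi.
  have [se|] := ltP `|s| e1; last by exists (0, 0).
  have [g /affine_symmetryP[M [c [Mc ->]]] gX] := homO _ _ OX (e1P _ se).
  by exists (M, c).
have [p pP] := choice choose.
have mine : 0 < Num.min e e1 by rewrite lt_min e0.
have [s [t [s0 t0 st]]] := interval_uncountable_collision (fun s => code (p s)) mine.
move: s0 t0; rewrite !lt_min => /andP[s0 /andP[se se1]] /andP[t0 /andP[te te1]].
rewrite /code; have [kV kc] := kfP (p t); move: kV kc; set k := kf (p t) => kV kc.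
move=> -[Ek]; rewrite Ek => HM Hc.
have [|Ss Es] := pP s; first by rewrite gtr0_norm.
have [|St Et] := pP t; first by rewrite gtr0_norm.
move: (Ss) (St) => [Mus _] [Mut _].
exists s, t, (invmx (p t).1 *m (p s).1), (- (p t).2 *m invmx (p t).1 *m (p s).1 + (p s).2).
split; rewrite ?s0 ?t0 //; first by apply: matrix_symmetry_comp => //; exact: matrix_symmetryV.
have dM : `|(p s).1 - (p t).1| <= (N k)^-1.
  apply: mx_norm_le => [|i j]; first by rewrite invr_ge0 ltW.
  by rewrite 2!mxE; apply: floor_eq_close => //; move/matrixP/(_ i j): HM; rewrite !mxE.
have dc : `|(p s).2 - (p t).2| <= (N k)^-1.
  apply: mx_norm_le => [|i j]; first by rewrite invr_ge0 ltW.
  by rewrite 2!mxE; apply: floor_eq_close => //; move/matrixP/(_ i j): Hc; rewrite !mxE.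
have ME : invmx (p t).1 *m (p s).1 - 1%:M = invmx (p t).1 *m ((p s).1 - (p t).1).
  by rewrite mulmxBr mulVmx.
have M1 : `|invmx (p t).1 *m (p s).1 - 1%:M| <= mk k * (N k)^-1.
  rewrite ME; apply: (le_trans (mx_norm_mulmx _ _)); apply: ler_pM => //.
  by rewrite ler_wpM2l.
have NE : (N k)^-1 * (1 + mk k + mk k ^+ 2) = e.
  by rewrite /N invf_div divfK // gt_eqF // -addrA ltr_pwDl // addr_ge0 // sqr_ge0.
have NV0 : 0 <= (N k)^-1 by rewrite invr_ge0 ltW.
split.
- by rewrite -affine_map_comp -Et affine_mapK // Es.
- apply: (le_trans M1); rewrite -[leRHS]NE mulrC ler_wpM2l //.
  by rewrite addrAC lerDr addr_ge0 // sqr_ge0.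
have -> : - (p t).2 *m invmx (p t).1 *m (p s).1 + (p s).2 =
    ((p s).2 - (p t).2) - (p t).2 *m (invmx (p t).1 *m (p s).1 - 1%:M).
  rewrite mulmxBr mulmx1 !mulNmx -mulmxA; move: (_ *m (_ *m _)) => q.
  by apply/matrixP=> i j; rewrite !mxE; ring.
apply: (le_trans (ler_normB _ _)).
have h : `|(p t).2 *m (invmx (p t).1 *m (p s).1 - 1%:M)| <= mk k * (mk k * (N k)^-1).
  apply: (le_trans (mx_norm_mulmx _ _)); apply: ler_pM => //.
  by rewrite ler_wpM2l.
apply: (le_trans (lerD dc h)); rewrite -[leRHS]NE.
rewrite -subr_ge0; set q := (N k)^-1 in NV0 *.
have -> : q * (1 + mk k + mk k ^+ 2) - (q + mk k * (mk k * q)) = q * mk k by ring.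
exact: mulr_ge0.
Qed.

End Pigeonhole.

(** * Positive definite matrices, coordinates and boundaries *)

Section Cholesky.
Variable R : realType.

(** By induction on the size: the Schur complement N' of the first diagonal
    entry is again positive definite. *)
Lemma cholesky (n : nat) (H : 'M[R]_n) : H^T = H ->
  (forall v, v != 0 -> 0 < bform H v v) ->
  exists2 P : 'M[R]_n, P \in unitmx & H = P *m P^T.
Proof.
elim: n H => [|n IH] H HT Hpos.
  by exists 1%:M; [exact: unitmx1|apply/matrixP => -[]].
pose H' : 'M[R]_(1 + n) := H.
have pos (u : 'rV[R]_(1 + n)) : u != 0 -> 0 < (u *m H' *m u^T) ord0 ord0 := @Hpos u.
pose a := H' 0 0; pose v := ursubmx H'; pose N := drsubmx H'.
have a_blk : ulsubmx H' = a%:M.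
  by apply/matrixP=> i j; rewrite !ord1 !mxE /=; congr (H' _ _); apply/val_inj.
have HB : H' = block_mx a%:M v v^T N.
  rewrite -[LHS]submxK a_blk; congr block_mx.
  by rewrite /v trmx_ursub; congr dlsubmx; rewrite /H' HT.
have NT : N^T = N by rewrite /N trmx_drsub; congr drsubmx; rewrite /H' HT.
have a0 : 0 < a.
  have e0 : row_mx (1%:M : 'M[R]_1) (0 : 'rV[R]_n) != 0.
    apply/eqP => /matrixP/(_ 0 (lshift n 0)); rewrite row_mxEl !mxE /= => /eqP.
    by rewrite oner_eq0.
  have := pos _ e0; rewrite HB tr_row_mx mul_row_block mul_row_col.
  by rewrite !mul0mx !addr0 trmx1 trmx0 mulmx0 addr0 mulmx1 mul1mx mxE eqxx mulr1n.
pose N' := N - a^-1 *: (v^T *m v).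
have [|w w0|P' P'u NE] := IH N'.
- by rewrite /N' linearB /= linearZ /= trmx_mul trmxK NT.
- pose k := - a^-1 *: (w *m v^T).
  have u0 : row_mx k w != 0.
    apply: contraNneq w0 => /(congr1 rsubmx); rewrite row_mxKr => ->.
    by rewrite linear0.
  have := pos _ u0; rewrite /bform HB tr_row_mx mul_row_block mul_row_col.
  suff -> : (k *m a%:M + w *m v^T) *m k^T + (k *m v + w *m N) *m w^T = w *m N' *m w^T by [].
  have -> : k *m a%:M + w *m v^T = 0.
    by rewrite mul_mx_scalar /k scalerA mulrN mulfV ?gt_eqF // scaleN1r addNr.
  rewrite mul0mx add0r; congr (_ *m _).
  by rewrite /N' mulmxBr addrC /k -scalemxAl scaleNr -scalemxAr mulmxA.
pose r := Num.sqrt a.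
have r0 : r != 0 by rewrite gt_eqF // sqrtr_gt0.
have r2 : r * r = a by rewrite -expr2 sqr_sqrtr // ltW.
pose B := block_mx r%:M 0 (r^-1 *: v^T) P'.
have HBB : H' = B *m B^T.
  rewrite HB /B tr_block_mx mulmx_block trmx0 !mul0mx !mulmx0 !addr0.
  rewrite tr_scalar_mx -scalar_mxM r2 linearZ /= trmxK.
  rewrite mul_scalar_mx scalerA mulfV // scale1r.
  rewrite mul_mx_scalar scalerA mulfV // scale1r; congr block_mx.
  rewrite -NE /N' -scalemxAl -scalemxAr scalerA -invfM r2.
  by rewrite addrC subrK.
exists (B : 'M[R]_n.+1) => //.
rewrite unitmxE; have -> : \det (B : 'M[R]_n.+1) = r * \det P'.
  by have := det_lblock r%:M (r^-1 *: v^T) P'; rewrite det_scalar1.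
by rewrite unitrM unitfE r0 -unitmxE.
Qed.

End Cholesky.

Section Coordinates.
Variables (R : realType) (n : nat).

Definition join_coords (y : 'rV[R]_n) (z : R) : 'rV[R]_n.+1 :=
  \row_j (if unlift ord_max j is Some i then y ord0 i else z).

Let widenE (i : 'I_n) : widen_ord (leqnSn n) i = lift ord_max i.
Proof. by apply/val_inj; rewrite /= /bump leqNgt ltn_ord. Qed.

Lemma join_coords_init y z (i : 'I_n) : join_coords y z ord0 (widen_ord (leqnSn n) i) =
  y ord0 i.
Proof. by rewrite mxE widenE liftK. Qed.

Lemma join_coords_last y z : join_coords y z ord0 ord_max = z.
Proof. by rewrite mxE unlift_none. Qed.

Lemma join_coordsK y z : init_coords (join_coords y z) = y.
Proof. by apply/rowP=> i; rewrite mxE join_coords_init. Qed.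

Lemma rowS_eq (x x' : 'rV[R]_n.+1) :
  init_coords x = init_coords x' -> x ord0 ord_max = x' ord0 ord_max -> x = x'.
Proof.
move=> hi hl; apply/rowP=> j; case: (unliftP ord_max j) => [i ->|->] //.
by move/rowP/(_ i): hi; rewrite !mxE widenE.
Qed.

Lemma init_coordsK x : join_coords (init_coords x) (x ord0 ord_max) = x.
Proof. by apply: rowS_eq; rewrite ?join_coordsK ?join_coords_last. Qed.

Lemma join_coords_norm_le y z (e : R) : `|y| <= e -> `|z| <= e -> `|join_coords y z| <= e.
Proof.
move=> ye ze; apply: mx_norm_le => [|i j]; first exact: le_trans ye.
rewrite ord1 mxE; case: unliftP => [k _|_] //.
exact: le_trans (mx_entry_le _ _ _) ye.
Qed.

Lemma init_coords_norm (x : 'rV[R]_n.+1) : `|init_coords x| <= `|x|.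
Proof. by apply: mx_norm_le => // i j; rewrite mxE; exact: mx_entry_le. Qed.

(** The blocks of a matrix for the splitting of R^(n+1) by [init_coords] and the
    last coordinate. As matrices act on the right, [blockb] is the horizontal
    part of the image of the vertical vector. *)
Definition blockA (M : 'M[R]_n.+1) : 'M[R]_n :=
  \matrix_(i, j) M (widen_ord (leqnSn n) i) (widen_ord (leqnSn n) j).
Definition blockb (M : 'M[R]_n.+1) : 'rV[R]_n := init_coords (row ord_max M).
Definition blockc (M : 'M[R]_n.+1) : 'cV[R]_n :=
  \col_i M (widen_ord (leqnSn n) i) ord_max.

Lemma affine_map_join_coords (M : 'M[R]_n.+1) c y z : affine_map M c (join_coords y z) =
  join_coords (y *m blockA M + z *: blockb M + init_coords c)
     ((y *m blockc M) ord0 ord0 + z * M ord_max ord_max + c ord0 ord_max).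
Proof.
apply: rowS_eq; last first.
  rewrite join_coords_last 2!mxE big_ord_recr /= join_coords_last; congr (_ + _ + _).
  by rewrite mxE; apply: eq_bigr => i _; rewrite join_coords_init mxE.
apply/rowP=> j; rewrite join_coordsK !mxE big_ord_recr /= join_coords_last; congr (_ + _ + _).
by apply: eq_bigr => i _; rewrite join_coords_init mxE.
Qed.

End Coordinates.

Section Boundary.
Variables (R : realType) (m : nat).
Implicit Types (S Omega : set 'rV[R]_m) (M : 'M[R]_m) (c x : 'rV[R]_m).

Lemma affine_map_continuous M c : continuous (affine_map M c).
Proof.
move=> x; have [d _] := diff_affine_graph M 0 c 0 (@differentiable_cst _ _ R^o 0 x).
have := differentiable_continuous d.
by congr continuous_at; apply/funext => w; rewrite scaler0 addr0.
Qed.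

Lemma nbhs_affine_map M c x (B : set 'rV[R]_m) : M \in unitmx ->
  nbhs x [set y | B (affine_map M c y)] <-> nbhs (affine_map M c x) B.
Proof.
move=> Mu; split => [H|]; last exact: affine_map_continuous.
have cont := @affine_map_continuous (invmx M) (- c *m invmx M) (affine_map M c x).
rewrite -(affine_mapK c Mu x) in H.
have K : nbhs (affine_map M c x) [set y | B (affine_map M c (affine_map (invmx M) (- c *m invmx M) y))].
  exact: cont H.
by apply: filterS K => y /=; rewrite affine_mapVK.
Qed.

(** This form is manifestly invariant under homeomorphisms. *)
Lemma boundaryE S x : boundary S x <-> ~ nbhs x (~` S) /\ ~ nbhs x S.
Proof.
rewrite /boundary; split => -[h1 h2]; split => //.
  by move=> /h1[y [Sy nSy]]; exact: nSy Sy.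
move=> B xB; apply: contrapT => SB; apply: h1; apply: filterS xB => y By Sy.
by apply: SB; exists y.
Qed.

Lemma boundary_preimage S M c x : M \in unitmx ->
  boundary [set y | S (affine_map M c y)] x <-> boundary S (affine_map M c x).
Proof.
move=> Mu; rewrite !boundaryE -(nbhs_affine_map c x S Mu).
by rewrite -(nbhs_affine_map c x (~` S) Mu).
Qed.

Lemma boundary_symmetry S M c x : matrix_symmetry S M c ->
  boundary S x <-> boundary S (affine_map M c x).
Proof.
move=> [Mu H]; rewrite -boundary_preimage //.
have <- : S = [set y | S (affine_map M c y)] by apply/seteqP; split => y /= /H.
by [].
Qed.

Lemma not_boundary S x : open S -> ~ boundary S x -> S x \/ nbhs x (~` S).
Proof.
move=> oS nb; case: (pselect (S x)) => Sx; first by left.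
right; apply: contrapT => h; apply: nb; apply/boundaryE; split => //.
by move=> /nbhs_singleton.
Qed.

Lemma open_not_boundary S x : open S -> S x -> ~ boundary S x.
Proof. by move=> oS Sx /boundaryE[_]; apply; exact: open_nbhs_nbhs. Qed.

(** The times at which the path is in S form a subset of [0, 1] that is both
    open and closed in it. *)
Lemma path_avoiding_boundary S (gam : R -> 'rV[R]_m) : open S ->
  (forall t, 0 <= t <= 1 -> {for t, continuous gam}) ->
  (forall t, 0 <= t <= 1 -> ~ boundary S (gam t)) ->
  S (gam 0) -> S (gam 1).
Proof.
move=> oS cg nb S0.
have conn := @segment_connected R 0 1.
have E : [set t | 0 <= t <= 1 /\ S (gam t)] = `[0, 1]%classic.
  apply: conn.
  - by exists 0; split => //; rewrite lexx ler01.
  - exists ([set t | S (gam t)]^°); first exact: open_interior.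
    apply/seteqP; split => t /=; rewrite in_itv /=; last first.
      by move=> [t01 /nbhs_singleton].
    by move=> [t01 St]; split => //; apply: (cg t t01); exact: open_nbhs_nbhs.
  - exists (~` ([set t | ~ S (gam t)]^°)).
      by apply: open_closedC; exact: open_interior.
    apply/seteqP; split => t /=; rewrite in_itv /=.
      by move=> [t01 St]; split => // /nbhs_singleton.
    move=> [t01 nn]; split => //; apply: contrapT => nS; apply: nn.
    have [//|] := not_boundary oS (nb t t01).
    exact: (cg t t01).
have : [set t | 0 <= t <= 1 /\ S (gam t)] 1 by rewrite E /= in_itv /= ler01 lexx.
by case.
Qed.

End Boundary.

(** * One side of the hypersurface *)

Section OneSide.
Variables (R : realType) (n : nat).
Implicit Types (y : 'rV[R]_n) (x : 'rV[R]_n.+1).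

Lemma join_coords_linear y z : join_coords y z =
  y *m (\matrix_(i, j) (j == widen_ord (leqnSn n) i)%:R) + z *: delta_mx ord0 ord_max.
Proof.
have wne (i : 'I_n) : ord_max != widen_ord (leqnSn n) i.
  by apply/eqP => /(congr1 val) /= e; have := ltn_ord i; rewrite -e ltnn.
apply: rowS_eq; last first.
  rewrite join_coords_last !mxE !eqxx mulr1 big1 ?add0r // => i _.
  by rewrite mxE (negPf (wne i)) mulr0.
apply/rowP=> k; rewrite join_coordsK !mxE eqxx /= [_ == ord_max]eq_sym (negPf (wne k)).
rewrite mulr0 addr0 (bigD1 k) //= !mxE eqxx mulr1 big1 ?addr0 // => i ik.
rewrite mxE; case: eqP => [/(congr1 val) /= /val_inj e|_]; last by rewrite mulr0.
by rewrite e eqxx in ik.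
Qed.

(** The origin is adherent to O, so that O contains a point close to it, which
    lies strictly above or below the graph; k is the sign of its height over the
    graph. Any other point on the same side is joined to it by the path along
    which the first coordinates and the height over the graph are affine
    functions of time, and this path avoids the boundary. *)
Lemma one_side (O : set 'rV[R]_n.+1) (f : 'rV[R]_n -> R^o) :
  open O -> f 0 = 0 -> (forall v, 'D_v f 0 = 0) ->
  (\forall y \near (0 : 'rV[R]_n), differentiable f y) ->
  (\forall x \near (0 : 'rV[R]_n.+1), boundary O x <-> x ord0 ord_max = f (init_coords x)) ->
  exists k rho : R, [/\ k ^+ 2 = 1, 0 < rho & forall y t, `|y| < rho -> 0 < t < rho ->
    O (join_coords y (f y + k * t))].
Proof.
move=> oO f0 Df0 df bd.
have f_small := diff_first_order ltr01 (nbhs_singleton df).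
have /ball0_near[r1 r10 r1P] := df.
have /ball0_near[r2 r20 r2P] := f_small.
have /ball0_near[r3 r30 r3P] := bd.
pose rho := Num.min r1 (Num.min r2 r3) / 2.
have rho0 : 0 < rho by rewrite divr_gt0 // !lt_min r10 r20.
have [rr1 rr2 rr3] : [/\ 2 * rho <= r1, 2 * rho <= r2 & 2 * rho <= r3].
  by rewrite /rho mulrC divfK ?pnatr_eq0 // !ge_min !lexx !orbT.
have lt2 (x : R) : x < rho -> x < 2 * rho by move: rho0; lra.
have fy y : `|y| < rho -> `|f y| <= `|y|.
  move=> yr; have := r2P y (lt_le_trans (lt2 _ yr) rr2).
  by rewrite f0 Df0 !subr0 mul1r.
have nb y t : `|y| < rho -> `|t| < rho -> t != 0 -> ~ boundary O (join_coords y (f y + t)).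
  move=> yr tr t0 /(r3P _ _); rewrite join_coords_last join_coordsK.
  have le : `|join_coords y (f y + t)| < r3.
    apply: (@le_lt_trans _ _ (`|y| + `|t|)).
      apply: join_coords_norm_le; first by rewrite lerDl.
      by apply: (le_trans (ler_normD _ _)); rewrite lerD2r fy.
    by apply: lt_le_trans rr3; rewrite mulrDl mul1r ltrD.
  by move=> /(_ le)/eqP; rewrite -subr_eq0 addrAC subrr add0r (negPf t0).
have [x1 [Ox1 x1r]] : exists x, O x /\ `|x| < rho / 2.
  have b0 : boundary O 0.
    have := nbhs_singleton bd; rewrite mxE => ->.
    by rewrite (_ : init_coords 0 = 0) ?f0 //; apply/rowP=> i; rewrite !mxE.
  case: b0 => /(_ [set x | `|x| < rho / 2]) b0 _.
  have [|x [Ox xr]] := b0; last by exists x.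
  by apply/ball0_near; exists (rho / 2) => //; rewrite divr_gt0.
pose y1 := init_coords x1; pose t1 := x1 ord0 ord_max - f y1.
have y1r : `|y1| < rho / 2 by apply: le_lt_trans x1r; exact: init_coords_norm.
have half : rho / 2 < rho by rewrite ltr_pdivrMr // ltr_pMr // ltr1n.
have y1r' := lt_trans y1r half.
have t1r : `|t1| < rho.
  rewrite [ltRHS](splitr rho); apply: (le_lt_trans (ler_normB _ _)); apply: ltrD.
    by apply: le_lt_trans x1r; exact: mx_entry_le.
  exact: le_lt_trans (fy _ y1r') y1r.
have x1E : x1 = join_coords y1 (f y1 + t1) by rewrite /t1 addrC subrK init_coordsK.
have t10 : t1 != 0.
  apply/eqP => t10; have := open_not_boundary oO Ox1; apply.
  apply/(r3P x1); last by apply/eqP; rewrite -subr_eq0 -/y1 -/t1 t10.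
  by apply: lt_le_trans rr3; apply: lt2; exact: lt_trans half.
pose k := Num.sg t1.
have kt1 : t1 = k * `|t1| by rewrite /k -numEsg.
have k2 : k ^+ 2 = 1 by rewrite /k sqr_sg t10.
have kn : `|k| = 1 by rewrite /k normr_sg t10.
exists k, rho; split => // y t yr /andP[t0 tr].
pose Y (th : R) := y1 + th *: (y - y1).
pose T (th : R) := `|t1| + th * (t - `|t1|).
pose gam th := join_coords (Y th) (f (Y th) + k * T th).
have Yr th : 0 <= th <= 1 -> `|Y th| < rho.
  move=> /andP[th0 th1].
  have -> : Y th = (1 - th) *: y1 + th *: y by apply/rowP=> i; rewrite !mxE; ring.
  apply: (le_lt_trans (ler_normD _ _)); rewrite !normrZ !ger0_norm ?subr_ge0 //.
  case: (ltgtP th 0) th0 => // [th0|->] _; last by rewrite subr0 mul1r mul0r addr0.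
  have -> : rho = (1 - th) * rho + th * rho by ring.
  apply: ler_ltD; last by rewrite ltr_pM2l.
  by rewrite ler_wpM2l ?subr_ge0 // ltW.
have Tr th : 0 <= th <= 1 -> 0 < T th < rho.
  move=> /andP[th0 th1]; have nt1 : 0 < `|t1| by rewrite normr_gt0.
  have -> : T th = (1 - th) * `|t1| + th * t by rewrite /T; ring.
  case: (ltgtP th 0) th0 => // [th0|->] _; last by rewrite subr0 mul1r mul0r addr0 nt1.
  apply/andP; split.
    by apply: ltr_wpDl; rewrite ?mulr_gt0 // mulr_ge0 ?subr_ge0.
  have -> : rho = (1 - th) * rho + th * rho by ring.
  apply: ler_ltD; last by rewrite ltr_pM2l.
  by rewrite ler_wpM2l ?subr_ge0 // ltW.
have -> : join_coords y (f y + k * t) = gam 1.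
  have e1 : Y 1 = y by rewrite /Y scale1r addrC subrK.
  have e2 : T 1 = t by rewrite /T mul1r addrC subrK.
  by rewrite /gam e1 e2.
apply: (path_avoiding_boundary oO).
- move=> th th01; apply: differentiable_continuous.
  have dYl : differentiable (fun s : R => s *: (y - y1)) th by exact: differentiableZl.
  have dY : differentiable Y th := differentiableD (differentiable_cst y1 th) dYl.
  have dfY : differentiable f (Y th) by apply: r1P; apply: lt_le_trans rr1; apply/lt2/Yr.
  pose E : 'M[R]_(n, n.+1) := \matrix_(i, j) (j == widen_ord (leqnSn n) i)%:R.
  have [dphi _] := diff_affine_graph E (delta_mx ord0 ord_max) 0 0 dfY.
  have d1 := differentiable_comp dY dphi.
  have dTl : differentiable (fun s : R =>
    s *: ((k * (t - `|t1|)) *: (delta_mx ord0 ord_max : 'rV[R]_n.+1))) th.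
    exact: differentiableZl.
  have d2 := differentiableD d1 (differentiableD
    (differentiable_cst ((k * `|t1|) *: (delta_mx ord0 ord_max : 'rV[R]_n.+1)) th) dTl).
  pose G := (((fun w : 'rV[R]_n => w *m E + f w *: delta_mx ord0 ord_max + 0) \o Y) +
    (cst ((k * `|t1|) *: (delta_mx ord0 ord_max : 'rV[R]_n.+1)) +
    (fun s : R => s *: ((k * (t - `|t1|)) *: (delta_mx ord0 ord_max : 'rV[R]_n.+1))))).
  have -> : gam = G; last exact: d2.
  apply/funext => s; rewrite /gam join_coords_linear -/E.
  rewrite -[RHS]/(Y s *m E + f (Y s) *: delta_mx ord0 ord_max + 0 +
     ((k * `|t1|) *: delta_mx ord0 ord_max +
     s *: ((k * (t - `|t1|)) *: delta_mx ord0 ord_max))).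
  rewrite addr0 -addrA; congr (_ + _); rewrite scalerA -!scalerDl; congr (_ *: _).
  by rewrite /T; ring.
- move=> th th01; apply: nb; first exact: Yr.
    by have /andP[T0 T1] := Tr _ th01; rewrite normrM kn mul1r gtr0_norm.
  have /andP[T0 _] := Tr _ th01; apply: mulf_neq0; last by rewrite gt_eqF.
  by rewrite -normr_eq0 kn oner_eq0.
have e1 : Y 0 = y1 by rewrite /Y scale0r addr0.
have e2 : T 0 = `|t1| by rewrite /T mul0r addr0.
by rewrite /gam e1 e2 -kt1 -x1E.
Qed.

End OneSide.

(** * The hypersurface is a quadric *)

Section Quadric.
Variables (R : realType) (n : nat).

Lemma join_coords_scale (k z : R) (y : 'rV[R]_n) : k *: join_coords y z =
  join_coords (k *: y) (k * z).
Proof. by apply/rowP=> j; rewrite !mxE; case: unlift => [i|] //; rewrite mxE. Qed.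

Lemma graph_invariance (O : set 'rV[R]_n.+1) (f : 'rV[R]_n -> R^o)
    (M : 'M[R]_n.+1) (c : 'rV[R]_n.+1) (r : R) :
  (forall x, `|x| < r -> (boundary O x <-> x ord0 ord_max = f (init_coords x))) ->
  (\forall y \near (0 : 'rV[R]_n), `|f y| <= `|y|) ->
  matrix_symmetry O M c -> `|c| < r ->
  \forall y \near (0 : 'rV[R]_n),
    f (y *m blockA M + f y *: blockb M + init_coords c) =
    (y *m blockc M) ord0 ord0 + M ord_max ord_max * f y + c ord0 ord_max.
Proof.
move=> bd /ball0_near[r1 r10 f1] sym cr.
have r0 : 0 < r by exact: le_lt_trans cr.
pose K := n.+1%:R * `|M| + 1.
have K0 : 0 < K by rewrite ltr_wpDl // mulr_ge0.
apply/ball0_near; exists (Num.min (Num.min r1 r) ((r - `|c|) / K)).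
  by rewrite !lt_min r10 r0 divr_gt0 // subr_gt0.
move=> y; rewrite !lt_min => /andP[/andP[y1 y2] y3].
have ptn : `|join_coords y (f y)| <= `|y| by apply: join_coords_norm_le => //; exact: f1.
have b1 : boundary O (join_coords y (f y)).
  by apply/bd; [exact: le_lt_trans y2|rewrite join_coords_last join_coordsK].
have nx : `|affine_map M c (join_coords y (f y))| < r.
  apply: (le_lt_trans (ler_normD _ _)).
  rewrite -ltrBrDr; apply: (@le_lt_trans _ _ (K * `|y|)); last by rewrite mulrC -ltr_pdivlMr.
  apply: (le_trans (mx_norm_mulmx _ _)); rewrite mulrAC mulrDl mul1r.
  apply: (@le_trans _ _ (n.+1%:R * `|M| * `|y|)); last by rewrite lerDl.
  by rewrite ler_wpM2l // mulr_ge0.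
move/(boundary_symmetry _ sym): b1 => /(proj1 (bd _ nx)).
by rewrite affine_map_join_coords join_coords_last join_coordsK => <-; rewrite [f y * _]mulrC.
Qed.

(** The combination of the previous parts, applied to a point X of the affine
    normal at the origin on the side of the graph that lies in O. *)
Lemma graph_is_quadric (O : set 'rV[R]_n.+1) (f : 'rV[R]_n -> R^o) :
  open O -> affinely_homogeneous O ->
  (\forall x \near (0 : 'rV[R]_n.+1), boundary O x <-> x ord0 ord_max = f (init_coords x)) ->
  smooth_near f 0 -> f 0 = 0 -> (forall v, 'D_v f 0 = 0) ->
  definite_form (hessian_form f 0) ->
  exists (eta : 'rV[R]_n) (P : 'M[R]_n) (sg : R), [/\ P \in unitmx, sg ^+ 2 = 1 &
    \forall y \near (0 : 'rV[R]_n), f y = 2^-1 * (sg * sqnorm ((y - f y *: eta) *m P))].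
Proof.
move=> oO homO bd /ball0_near[r r0 sm0] f0 Df0 def.
have sm : forall y : 'rV[R]_n, `|y| < r -> smooth_at f y by exact: sm0.
have n0 : `|0 : 'rV[R]_n| < r by rewrite normr0.
have df : \forall y \near (0 : 'rV[R]_n), differentiable f y.
  by apply: filterS (near_norm_lt n0) => y /sm/smooth_at_differentiable.
have ddf w : differentiable ('D_w f) 0.
  by apply: smooth_at_differentiable; apply: smooth_at_derive; exact: sm.
pose H0 := hessian f 0.
have HT : H0^T = H0 by exact: (hessian0_sym r0 sm).
have HE v : hessian_form f 0 v = bform H0 v v by exact: (derive2E sm).
have [sg [P [sg2 Pu HP]]] : exists sg P, [/\ sg ^+ 2 = 1, P \in unitmx & H0 =
  sg *: (P *m P^T)].
  case: def => def.
    have [||P Pu HP] := cholesky (H := H0) => //; first by move=> v /def; rewrite HE.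
    by exists 1, P; rewrite expr1n scale1r.
  have [||P Pu HP] := cholesky (H := - H0).
  - by rewrite linearN /= HT.
  - by move=> v /def h; rewrite /bform mulmxN mulNmx mxE oppr_gt0 -/(bform H0 v v) -HE.
  by exists (-1), P; rewrite sqrrN expr1n scaleN1r -HP opprK.
have Hu : H0 \in unitmx.
  have : H0 *m (sg *: invmx (P *m P^T)) = 1%:M.
    rewrite HP -scalemxAl -scalemxAr scalerA -expr2 sg2 scale1r mulmxV //.
    by rewrite unitmx_mul unitmx_tr Pu.
  by case/mulmx1_unit.
have [eta [eps [eps0 iso]]] := isotropy_of_normal_line r0 sm f0 Df0 Hu.
have [k [rho [k2 rho0 inside]]] := one_side oO f0 Df0 df bd.
have /ball0_near[r6 r60 bdP] := bd.
pose D := `|eta| + 1.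
have D1 : 1 <= D by rewrite lerDr.
have D0 : 0 < D by exact: lt_le_trans D1.
have f_small (e : R) : 0 < e -> \forall v \near (0 : 'rV[R]_n), `|f v| <= e * `|v|.
  move=> e0; have := diff_first_order e0 (nbhs_singleton df).
  by apply: filterS => v; rewrite f0 Df0 !subr0.
have k00 : 0 < (2 * D)^-1 by rewrite invr_gt0 mulr_gt0.
have /ball0_near[r5 r50 f5] := f_small _ k00.
pose m := Num.min eps (Num.min rho r5).
have m0 : 0 < m by rewrite !lt_min eps0 rho0.
have [me mr m5] : [/\ m <= eps, m <= rho & m <= r5] by rewrite !ge_min !lexx !orbT.
(* tau is the height of X; the factor D = |eta| + 1 accounts for the slope of
   the affine normal *)
pose tau := m / (4 * D).
have tau0 : 0 < tau by rewrite divr_gt0 // mulr_gt0.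
have tauD : tau * D = m / 4 by rewrite /tau; field; rewrite gt_eqF.
have tauE : tau * `|eta| <= m / 4 by rewrite -tauD ler_wpM2l ?(ltW tau0) // lerDl.
have tau1 : tau <= m / 4 by rewrite -tauD ler_peMr // ltW.
have m4 : m / 4 < m by rewrite ltr_pdivrMr // ltr_pMr // ltr1n.
have kn : `|k| = 1.
  apply/eqP; rewrite -(@eqrXn2 _ 2) // ?expr1n -?normrX ?k2 ?normr1 //.
pose s0 := k * tau.
have s0n : `|s0| = tau by rewrite normrM kn mul1r gtr0_norm.
have s00 : s0 != 0 by rewrite -normr_eq0 s0n gt_eqF.
pose X := join_coords (s0 *: eta) s0.
have OX : O X.
  have nE : `|s0 *: eta| <= m / 4 by rewrite normrZ s0n.
  have fE : `|f (s0 *: eta)| <= tau / 2.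
    apply: (le_trans (f5 _ _)); first by apply: (le_lt_trans nE); exact: lt_le_trans m5.
    rewrite normrZ s0n invfM mulrCA ler_wpM2l ?(ltW tau0) // -mulrA ler_piMr ?invr_ge0 //.
    by rewrite mulrC ler_pdivrMr // mul1r lerDl.
  have -> : X = join_coords (s0 *: eta) (f (s0 *: eta) + k * (tau - k * f (s0 *: eta))).
    by rewrite mulrBr [k * (k * _)]mulrA -expr2 k2 mul1r addrC subrK.
  apply: inside; first by apply: (le_lt_trans nE); exact: lt_le_trans mr.
  have : `|k * f (s0 *: eta)| <= tau / 2 by rewrite normrM kn mul1r.
  rewrite ler_norml => /andP[h1 h2].
  apply/andP; split; first by move: tau0 h1 h2; lra.
  apply: (lt_le_trans _ mr); move: tau0 tau1 m0 h1 h2; lra.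
pose e' := Num.min (4^-1) (Num.min eps (r6 / 2)).
have e'0 : 0 < e' by rewrite !lt_min invr_gt0 ltr0n eps0 divr_gt0.
have [e1 e2 e3] : [/\ e' <= 4^-1, e' <= eps & e' <= r6 / 2] by rewrite !ge_min !lexx !orbT.
have [s [t [M [c [/andP[s0' se] /andP[t0' te] st sym [gX M1 c1]]]]]] :=
  small_symmetry X oO homO OX e'0.
pose S := (1 + t) * s0; pose S' := (1 + s) * s0.
have gX' : affine_map M c (join_coords (S *: eta) S) = join_coords (S' *: eta) S'.
  have XE (u : R) : join_coords (((1 + u) * s0) *: eta) ((1 + u) * s0) = X + u *: X.
    by rewrite -scalerA -join_coords_scale -/X scalerDl scale1r.
  by rewrite !XE.
have le4 (u : R) : 0 < u < e' -> `|(1 + u) * s0| <= eps.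
  move=> /andP[u0 ue]; rewrite normrM s0n gtr0_norm ?addr_gt0 //.
  apply: (le_trans _ me); apply: (@le_trans _ _ (2 * (m / 4))).
    apply: ler_pM => //; rewrite ?addr_ge0 ?(ltW u0) ?(ltW tau0) //.
    by move: ue e1; lra.
  by move: m0; lra.
have Sn0 : S != 0 by rewrite mulf_neq0 // gt_eqF // addr_gt0.
have entry i j : `|(M - 1%:M) i j| <= e' by apply: le_trans M1; exact: mx_entry_le.
have widen_max (j : 'I_n) : ord_max == widen_ord (leqnSn n) j = false.
  by apply/eqP => /(congr1 val) /= ee; have := ltn_ord j; rewrite -ee ltnn.
have nA : `|blockA M| <= 2.
  apply: mx_norm_le => // i j; rewrite mxE.
  have -> : M (widen_ord (leqnSn n) i) (widen_ord (leqnSn n) j) =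
    (M - 1%:M) (widen_ord (leqnSn n) i) (widen_ord (leqnSn n) j) +
    (1%:M : 'M[R]_n.+1) (widen_ord (leqnSn n) i) (widen_ord (leqnSn n) j).
    by rewrite 2!mxE subrK.
  apply: (le_trans (ler_normD _ _)); apply: (@le_trans _ _ (e' + 1)); last by move: e1; lra.
  by rewrite lerD ?entry // [1%:M _ _]mxE; case: eqP => _; rewrite ?normr1 ?normr0.
have nb : `|blockb M| <= 1.
  apply: mx_norm_le => // i j; rewrite 2!mxE.
  have := entry ord_max (widen_ord (leqnSn n) j).
  by rewrite 3!mxE widen_max subr0 => /le_trans; apply; move: e1; lra.
have nc : `|init_coords c| <= eps by apply: (le_trans (init_coords_norm _));
  exact: le_trans e2.
have nd : `|M ord_max ord_max - 1| <= 4^-1.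
  by have := entry ord_max ord_max; rewrite 3!mxE eqxx mulr1n => /le_trans; apply.
have cr6 : `|c| < r6.
  by apply: (le_lt_trans c1); apply: (le_lt_trans e3); rewrite ltr_pdivrMr // ltr_pMr // ltr1n.
have f1 : \forall y \near (0 : 'rV[R]_n), `|f y| <= `|y|.
  by have := f_small _ ltr01; apply: filterS => y; rewrite mul1r.
have inv := graph_invariance bdP f1 sym cr6.
have [] := iso _ _ _ _ _ _ S S' nA nb nc nd Sn0 _ _ inv.
- by apply: le4; rewrite t0'.
- by apply: le4; rewrite s0'.
- have := congr1 (@init_coords R n) gX'; rewrite affine_map_join_coords !join_coordsK => <-.
  by rewrite -scalemxAl -[LHS]addrA [LHS]addrC.
- have := congr1 (fun x : 'rV[R]_n.+1 => x ord0 ord_max) gX';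
    rewrite affine_map_join_coords !join_coords_last => <-.
  have -> : (S *: eta *m blockc M) ord0 ord0 = S * (eta *m blockc M) ord0 ord0.
    by rewrite -scalemxAl [LHS]mxE.
  by rewrite -[LHS]addrA [LHS]addrC.
move=> a0 ee0 c0 dE [bE AH]; rewrite {}a0 {}c0 {}ee0 in inv.
exists eta, P, sg; split => //.
have d01 : 0 < M ord_max ord_max < 1.
  rewrite dE /S /S' -mulf_div divff // mulr1.
  by rewrite divr_gt0 ?addr_gt0 //= ltr_pdivrMr ?addr_gt0 // mul1r ltrD2l.
have taylor (e : R) : 0 < e ->
    \forall v \near (0 : 'rV[R]_n), `|f v - 2^-1 * bform H0 v v| <= e * `|v| ^+ 2.
  move=> e0; have := taylor_second_order e0 f0 Df0 df ddf.
  by apply: filterS => v; rewrite -HE.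
have inv' : \forall v \near (0 : 'rV[R]_n),
    f (v *m blockA M + f v *: blockb M) = M ord_max ord_max * f v.
  by apply: filterS inv => v; rewrite !addr0 mulmx0 mxE add0r.
have := invariant_graph_quadric Pu HP sg2 AH d01 bE f_small taylor inv'.
by apply: filterS => v; rewrite (bform_sqnorm HP).
Qed.

End Quadric.

(** * The paraboloid *)

Section Paraboloid.
Variables (R : realType) (n : nat).

(** This matrix shears the direction (eta, 1) to the vertical, applies P
    horizontally and rescales the vertical by 2 sg, so that the quadric
    z = sg |(y - z eta) P|^2 / 2 becomes the paraboloid. *)
Definition straighten (P : 'M[R]_n) (eta : 'rV[R]_n) (sg : R) : 'M[R]_n.+1 :=
  \matrix_i (if unlift ord_max i is Some k then join_coords (row k P) 0
             else join_coords (- (eta *m P)) (2 * sg)).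

Lemma straighten_join_coords P eta sg y z :
  affine_map (straighten P eta sg) 0 (join_coords y z) =
    join_coords ((y - z *: eta) *m P) (2 * sg * z).
Proof.
have widenE (i : 'I_n) : widen_ord (leqnSn n) i = lift ord_max i.
  by apply/val_inj; rewrite /= /bump leqNgt ltn_ord.
rewrite affine_map_join_coords; congr join_coords.
  have -> : blockA (straighten P eta sg) = P.
    by apply/matrixP=> i j; rewrite 2!mxE {1}widenE liftK join_coords_init mxE.
  have -> : blockb (straighten P eta sg) = - (eta *m P).
    by apply/rowP=> j; rewrite 3!mxE unlift_none join_coords_init.
  have -> : init_coords (0 : 'rV[R]_n.+1) = 0 by apply/rowP=> i; rewrite !mxE.
  by rewrite addr0 mulmxBl -scalemxAl scalerN.
have -> : blockc (straighten P eta sg) = 0.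
  by apply/colP=> i; rewrite 2!mxE widenE liftK join_coords_last mxE.
have -> : straighten P eta sg ord_max ord_max = 2 * sg
  by rewrite mxE unlift_none join_coords_last.
by rewrite mulmx0 !mxE add0r addr0 mulrC.
Qed.

Lemma straighten_unit P eta sg : P \in unitmx -> sg != 0 -> straighten P eta sg \in unitmx.
Proof.
move=> Pu sg0; rewrite -row_free_unit -kermx_eq0; apply/rowV0P => v /sub_kermxP v0.
have := straighten_join_coords P eta sg (init_coords v) (v ord0 ord_max).
rewrite init_coordsK /affine_map v0 addr0 => H.
have z0 : v ord0 ord_max = 0.
  have := congr1 (fun x : 'rV[R]_n.+1 => x ord0 ord_max) H.
  rewrite join_coords_last mxE => /esym/eqP; rewrite !mulf_eq0 (negPf sg0) pnatr_eq0 /=.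
  by move/eqP.
have y0 : init_coords v = 0.
  have := congr1 (@init_coords R n) H; rewrite join_coordsK z0 scale0r subr0.
  have -> : init_coords (0 : 'rV[R]_n.+1) = 0 by apply/rowP=> i; rewrite !mxE.
  by move=> /esym h; rewrite -[init_coords v](mulmxK Pu) h mul0mx.
by rewrite -[v]init_coordsK y0 z0; apply/rowP=> j; rewrite !mxE; case: unlift =>
  [i|] //; rewrite mxE.
Qed.

Lemma sqnorm_sub (u v : 'rV[R]_n) : `|sqnorm u - sqnorm v| <= n%:R * (`|u - v| * `|u + v|).
Proof.
rewrite /sqnorm -sumrB; apply: (le_trans (ler_norm_sum _ _ _)).
have H (i : 'I_n) : true -> `|u ord0 i ^+ 2 - v ord0 i ^+ 2| <= `|u - v| * `|u + v|.
  move=> _; rewrite subr_sqr normrM; apply: ler_pM => //.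
    by have := mx_entry_le (u - v) ord0 i; rewrite !mxE.
  by have := mx_entry_le (u + v) ord0 i; rewrite !mxE.
by apply: (le_trans (ler_sum _ H)); rewrite sumr_const card_ord mulr_natl.
Qed.

(** The graph satisfies the equation of the quadric. Conversely, that equation
    determines z for a given y near the origin, because its right-hand side is a
    contraction in z there. *)
Lemma graph_near_paraboloid (f : 'rV[R]_n -> R) (P : 'M[R]_n) eta sg :
  sg ^+ 2 = 1 ->
  (\forall y \near (0 : 'rV[R]_n), `|f y| <= `|y|) ->
  (\forall y \near (0 : 'rV[R]_n), f y = 2^-1 * (sg * sqnorm ((y - f y *: eta) *m P))) ->
  \forall x \near (0 : 'rV[R]_n.+1),
    graph_over f x <-> @paraboloid R n (affine_map (straighten P eta sg) 0 x).
Proof.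
move=> sg2 /ball0_near[r1 r10 f1] /ball0_near[r2 r20 fq].
pose B := n%:R * (`|eta *m P| * (n%:R * (2 + 2 * `|eta|) * `|P|)).
have B0 : 0 <= B by rewrite !mulr_ge0 // addr_ge0 // mulr_ge0.
apply/ball0_near; exists (Num.min (Num.min r1 r2) (B + 1)^-1).
  by rewrite !lt_min r10 r20 invr_gt0 ltr_wpDl.
move=> x; rewrite !lt_min => /andP[/andP[x1 x2] x3].
pose y := init_coords x; pose z := x ord0 ord_max.
have yx : `|y| <= `|x| by exact: init_coords_norm.
have zx : `|z| <= `|x| by exact: mx_entry_le.
have par : @paraboloid R n (affine_map (straighten P eta sg) 0 x) <->
    z = 2^-1 * (sg * sqnorm ((y - z *: eta) *m P)).
  rewrite -[x]init_coordsK straighten_join_coords /paraboloid /graph_over /= join_coords_last join_coordsK -/y -/z.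
  rewrite -/(sqnorm _); set q := sqnorm _; split => [e|e].
    rewrite -e; have -> : 2^-1 * (sg * (2 * sg * z)) = sg ^+ 2 * z by field.
    by rewrite sg2 mul1r.
  rewrite {1}e; have -> : 2 * sg * (2^-1 * (sg * q)) = sg ^+ 2 * q by field.
  by rewrite sg2 mul1r.
rewrite par /graph_over /= -/y -/z.
have fy := fq y (le_lt_trans yx x2).
have fyn := f1 y (le_lt_trans yx x1).
split => [e|e]; first by rewrite e {1}fy.
have sgn : `|sg| = 1.
  by apply/eqP; rewrite -(@eqrXn2 _ 2) // ?expr1n -?normrX ?sg2 ?normr1.
have small : `|z - f y| <= `|z - f y| * (B * `|x|).
  have {1}-> : z - f y = 2^-1 * (sg * (sqnorm ((y - z *: eta) *m P) - sqnorm ((y - f y *: eta) *m P))).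
    by rewrite {1}e {1}fy; ring.
  rewrite normrM normrM sgn mul1r normfV normr_nat.
  apply: (@le_trans _ _ `|sqnorm ((y - z *: eta) *m P) - sqnorm ((y - f y *: eta) *m P)|).
    by rewrite ler_piMl // invf_le1 // ler1n.
  apply: (le_trans (sqnorm_sub _ _)); rewrite -mulmxBl -mulmxDl.
  have -> : y - z *: eta - (y - f y *: eta) = (f y - z) *: eta.
    by apply/rowP=> i; rewrite !mxE; ring.
  rewrite -scalemxAl normrZ distrC.
  have b1 : `|(y - z *: eta + (y - f y *: eta)) *m P| <=
    n%:R * ((2 + 2 * `|eta|) * `|x|) * `|P|.
    apply: (le_trans (mx_norm_mulmx _ _)); rewrite ler_wpM2r // ler_wpM2l //.
    apply: (le_trans (ler_normD _ _)).
    have le1 (t : R) : `|t| <= `|x| -> `|y - t *: eta| <= (1 + `|eta|) * `|x|.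
      move=> tx; apply: (le_trans (ler_normB _ _)); rewrite mulrDl mul1r lerD //.
      by rewrite normrZ mulrC ler_wpM2l.
    apply: (le_trans (lerD (le1 _ zx) (le1 _ (le_trans fyn yx)))).
    by rewrite -mulrDl ler_wpM2r // -[2 * _]/(2 * _) le_eqVlt; apply/orP; left;
      apply/eqP; ring.
  apply: (le_trans (ler_wpM2l _ (ler_wpM2l _ b1))) => //.
  by rewrite /B le_eqVlt; apply/orP; left; apply/eqP; ring.
apply/eqP; rewrite -subr_eq0 -normr_le0; apply: contraTT small; rewrite -!ltNge => pos.
rewrite gtr_pMr //.
move: x3; rewrite -[_^-1]mul1r ltr_pdivlMr ?ltr_wpDl // mulrC => h.
by apply: le_lt_trans h; rewrite ler_wpM2r // lerDl.
Qed.

End Paraboloid.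

Section Transport.
Variables (R : realType) (m : nat).
Implicit Types (Omega : set 'rV[R]_m) (M : 'M[R]_m) (c x : 'rV[R]_m).

Lemma matrix_symmetryP Omega M c :
  matrix_symmetry Omega M c -> affine_symmetry Omega (affine_map M c).
Proof.
move=> [Mu H]; split; first by exists M, c.
apply/seteqP; split => [x [y Oy <-]|x Ox]; first by apply/H.
exists (affine_map (invmx M) (- c *m invmx M) x); last exact: affine_mapVK.
by apply/H; rewrite affine_mapVK.
Qed.

Lemma homogeneous_preimage Omega M c : M \in unitmx -> affinely_homogeneous Omega ->
  affinely_homogeneous [set x | Omega (affine_map M c x)].
Proof.
move=> Mu hom x y /= Ox Oy.
have [g /affine_symmetryP[N [d [[Nu sym] ->]]] gx] := hom _ _ Ox Oy.
pose M' := invmx M; pose c' := - c *m invmx M.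
exists (affine_map (M *m (N *m M')) (c *m (N *m M') + (d *m M' + c'))).
  apply: matrix_symmetryP; split.
    by rewrite !unitmx_mul Mu Nu unitmx_inv.
  by move=> w /=; rewrite -!affine_map_comp affine_mapVK // sym.
by rewrite -!affine_map_comp gx affine_mapK.
Qed.

Lemma local_equivalence (S T : set 'rV[R]_m) M c p : M \in unitmx ->
  (\forall x \near p, S x <-> T (affine_map M c x)) ->
  exists (g : 'rV[R]_m -> 'rV[R]_m) (U V : set 'rV[R]_m),
    [/\ affine_transformation g, open U /\ U p, open V & g @` (S `&` U) = T `&` V].
Proof.
move=> Mu eqv; pose U := [set x | S x <-> T (affine_map M c x)]^°.
have US x : U x -> (S x <-> T (affine_map M c x)) by move=> /nbhs_singleton.
pose inv := affine_map (invmx M) (- c *m invmx M).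
exists (affine_map M c), U, [set x | U (inv x)]; split.
- by exists M, c.
- by split; [exact: open_interior|exact: eqv].
- apply: open_comp; last exact: open_interior.
  by move=> x _; exact: affine_map_continuous.
apply/seteqP; split => [x [y [Sy Uy] <-]|x [Tx Ux]].
  by split; [apply/(US _ Uy)|rewrite /= /inv affine_mapK].
exists (inv x); last exact: affine_mapVK.
by split => //; apply/(US _ Ux); rewrite /inv affine_mapVK.
Qed.

End Transport.

Theorem theorem1 (R : realType) (n : nat) (hn : (1 <= n)%N)
    (Omega : set 'rV[R]_n.+1) (D : set 'rV[R[i]]_n.+1)
    (hOmega : domain Omega) (hhom : affinely_homogeneous Omega)
    (hD : D = tube Omega)
    (Gamma : set 'rV[R]_n.+1)
    (hpart : boundary_part Omega Gamma)
    (hsmooth : smooth_hypersurface Gamma)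
    (hdef : definite_second_fundamental_form Gamma)
    (htrans : acts_locally_transitively Omega Gamma) :
  locally_affinely_equivalent Gamma (@paraboloid R n).
Proof.
case: hpart hOmega => Gamma0 [W [oW GammaE]] [_ oOmega _]; split => // p Gp.
have [f [g [[[M [c [Mu gE]]] sm gr] gp f0 Df0]] def] := hdef p Gp.
have {}gE : g = affine_map M c by apply/funext.
rewrite {}gE {g} in sm gr gp.
pose M' := invmx M; pose c' := - c *m invmx M.
have M'u : M' \in unitmx by rewrite unitmx_inv.
have p0 : affine_map M' c' 0 = p by rewrite -gp affine_mapK.
pose O := [set x | Omega (affine_map M' c' x)].
have oO : open O.
  by apply: open_comp => // x _; exact: affine_map_continuous.
have bd : \forall x \near (0 : 'rV[R]_n.+1), boundary O x <-> x ord0 ord_max =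
  f (init_coords x).
  have Wp : nbhs p W by apply: open_nbhs_nbhs; split => //; move: Gp; rewrite GammaE => -[].
  have H : \forall x \near p, boundary Omega x <-> graph_over f (affine_map M c x).
    apply: filterS2 gr Wp => x Gx Wx; rewrite -Gx GammaE.
    by split => [|[]].
  have cont := @affine_map_continuous R n.+1 M' c' 0.
  rewrite -p0 in H.
  have K : \forall x \near (0 : 'rV[R]_n.+1), boundary Omega (affine_map M' c' x) <->
      graph_over f (affine_map M c (affine_map M' c' x)) := cont _ H.
  apply: filterS K => x; rewrite affine_mapVK // => h.
  by apply: iff_trans h; exact: boundary_preimage.
have smf : smooth_near f 0.
  have -> : (0 : 'rV[R]_n) = init_coords (affine_map M c p) by rewrite gp;
    apply/rowP=> i; rewrite !mxE.
  exact: sm.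
have [eta [P [sg [Pu sg2 fq]]]] :=
  graph_is_quadric oO (homogeneous_preimage M'u hhom) bd smf f0 Df0 def.
have sg0 : sg != 0.
  by apply/eqP => s0; move/eqP: sg2; rewrite s0 expr0n /= eq_sym oner_eq0.
have f1 : \forall y \near (0 : 'rV[R]_n), `|f y| <= `|y|.
  have df : differentiable (f : _ -> R^o) 0 by exact: (nbhs_singleton smf [::]).
  have := diff_first_order ltr01 df.
  by apply: filterS => y; rewrite f0 Df0 !subr0 mul1r.
have near0 := graph_near_paraboloid sg2 f1 fq.
apply: (@local_equivalence R n.+1 Gamma (@paraboloid R n) (M *m straighten P eta sg)
  (c *m straighten P eta sg + 0)).
  by rewrite unitmx_mul Mu straighten_unit.
have near_p : \forall x \near p, graph_over f (affine_map M c x) <->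
    @paraboloid R n (affine_map (straighten P eta sg) 0 (affine_map M c x)).
  have cont := @affine_map_continuous R n.+1 M c p.
  have near1 : \forall x \near affine_map M c p, graph_over f x <->
      @paraboloid R n (affine_map (straighten P eta sg) 0 x) by rewrite gp.
  exact: (cont _ near1).
by apply: filterS2 gr near_p => x Gx; rewrite Gx affine_map_comp.
Qed.
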